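(* For every integer $n\geq 6$, \[ 2n-10n^{2/3}-7<f(n,4)\leq 2n-4. \] Consequently, \[ f(n,4)=2n-o(n)\qquad (n\to\infty). \] Equivalently (to the lower bound), for every $n\ge 6$, \[ \mu(n,\mathcal E_3)\geq \left\lfloor 2n-10n^{2/3}-7\right\rfloor . \]
   Context: All graphs are finite and simple (no loops or multiple edges). For a graph $G$ with vertex set $V(G)$ and edge set $E(G)$ and a permutation $\sigma$ of $V(G)$, $\sigma(G)$ denotes the graph with vertex set $V(G)$ and edge set $E(\sigma(G))=\{\sigma(u)\sigma(v):uv\in E(G)\}$. Put $I_G(\sigma):=|E(G)\cap E(\sigma(G))|$. For $k\ge 1$, \[ f(n,k):=\min\bigl\{|E(G)|:|V(G)|=n\text{ and } I_G(\sigma)\geq k\text{ for every permutation }\sigma\text{ of }V(G)\bigr\}. \] For a family of graphs $\mathcal F$, a permutation $\sigma$ of $V(G)$ is an $\mathcal F$-near-packing of $G$ if the graph formed by the common edges $E(G)\cap E(\sigma(G))$ belongs to $\mathcal F$. $\mu(n,\mathcal F)$ is the maximum integer $m$ such that every graph of order $n$ (number of vertices) and size (number of edges) at most $m$ has an $\mathcal F$-near-packing. For $r\ge 0$, $\mathcal E_r$ denotes the family of all graphs with at most $r$ edges; thus an $\mathcal E_3$-near-packing of $G$ is a permutation $\sigma$ of $V(G)$ with $I_G(\sigma)\le 3$. *)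

(* Defs.v *)
From HB Require Import structures.
From mathcomp Require Import all_boot all_order all_fingroup all_algebra.
From mathcomp Require Import all_classical all_reals all_analysis.

Set Implicit Arguments.
Unset Strict Implicit.
Unset Printing Implicit Defensive.

Import Order.TTheory GRing.Theory Num.Theory.

Local Open Scope classical_set_scope.
Local Open Scope nat_scope.

(* An edge uv is the two-element set [set u; v]; having exactly two elements
   excludes loops, and edges forming a set excludes multiple edges. *)
Record graph := Graph {
  vertex : finType;
  edges : {set {set vertex}};
  edges_card2 : forall e, e \in edges -> #|e| = 2
}.

Fact perm_graph_card2 (G : graph) (s : {perm vertex G}) e :
  e \in [set s @: e' | e' : {set vertex G} in edges G]%SET -> #|e| = 2.
Proof.
by move=> /imsetP[e' /edges_card2 e'2 ->]; rewrite card_imset//; exact: perm_inj.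
Qed.

Definition perm_graph (G : graph) (s : {perm vertex G}) : graph :=
  Graph (@perm_graph_card2 G s).

Fact common_graph_card2 (G : graph) (s : {perm vertex G}) e :
  e \in edges G :&: edges (perm_graph s) -> #|e| = 2.
Proof. by rewrite finset.in_setI => /andP[/edges_card2]. Qed.

Definition common_graph (G : graph) (s : {perm vertex G}) : graph :=
  Graph (@common_graph_card2 G s).

Definition common_size (G : graph) (s : {perm vertex G}) : nat :=
  #|edges G :&: edges (perm_graph s)|.

(* The junk value 0 is taken when there is no minimum (resp. maximum). *)
Definition set_min (A : set nat) : nat := xget 0 (A `&` lbound A).

Definition set_max (A : set int) : int := xget 0%R (A `&` ubound A).

Definition forcing_sizes (n k : nat) : set nat :=
  [set m | exists G : graph, [/\ #|vertex G| = n,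
     (forall s : {perm vertex G}, k <= common_size s) & #|edges G| = m]].

Definition f (n k : nat) : nat := set_min (forcing_sizes n k).

Definition near_packing (F : graph -> Prop) (G : graph) (s : {perm vertex G}) : Prop :=
  F (common_graph s).

Definition packable_sizes (n : nat) (F : graph -> Prop) : set int :=
  [set m | forall G : graph, #|vertex G| = n -> (#|edges G|%:Z <= m)%R ->
     exists s : {perm vertex G}, near_packing F s].

Definition mu (n : nat) (F : graph -> Prop) : int := set_max (packable_sizes n F).

Definition graphs_le (r : nat) (G : graph) : Prop := #|edges G| <= r.

(* The extrema defining f and mu are attained as soon as the complete graph of
   order n has enough edges. *)
Fact complete_graph_card2 (n : nat) e :
  e \in [set e : {set 'I_n} | #|e| == 2]%SET -> #|e| = 2.
Proof. by rewrite inE => /eqP. Qed.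

Definition complete_graph (n : nat) : graph := Graph (@complete_graph_card2 n).

Lemma complete_common_size n (s : {perm vertex (complete_graph n)}) :
  common_size s = 'C(n, 2).
Proof.
rewrite /common_size (_ : _ :&: _ = [set e : {set 'I_n} | #|e| == 2]%SET).
  by rewrite card_draws card_ord.
apply/finset.setIidPl/fintype.subsetP => /= e; rewrite inE => /eqP e2.
apply/imsetP; exists ((s^-1)%g @: e)%SET; first by rewrite inE card_imset ?e2//; exact: perm_inj.
by rewrite -imset_comp (eq_imset (g := id)) ?imset_id// => x /=; rewrite permKV.
Qed.

Lemma f_min n k : k <= 'C(n, 2) ->
  forcing_sizes n k (f n k) /\ lbound (forcing_sizes n k) (f n k).
Proof.
move=> kC; suff [m Am] : exists m, (forcing_sizes n k `&` lbound (forcing_sizes n k)) m.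
  exact: (xgetPex 0 (ex_intro _ m Am)).
have ex : exists m, `[< forcing_sizes n k m >].
  exists 'C(n, 2); apply/asboolP; exists (complete_graph n); split.
  - by rewrite card_ord.
  - by move=> s; rewrite complete_common_size.
  - by rewrite card_draws card_ord.
case: (ex_minnP ex) => m /asboolP Am mmin; exists m; split => // p Ap.
by rewrite leEnat; apply: mmin; apply/asboolP.
Qed.

Lemma mu_max n r : r < 'C(n, 2) ->
  packable_sizes n (graphs_le r) (mu n (graphs_le r)) /\
  ubound (packable_sizes n (graphs_le r)) (mu n (graphs_le r)).
Proof.
set A := packable_sizes _ _ => rC.
suff [m Am] : exists m, (A `&` ubound A) m by exact: (xgetPex 0%R (ex_intro _ m Am)).
have ub (p : int) : A p -> (p <= 'C(n, 2)%:Z)%R.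
  move=> Ap; rewrite leNgt; apply/negP => Cp.
  have [||s] := Ap (complete_graph n); first by rewrite card_ord.
    by rewrite card_draws card_ord ltW.
  rewrite /near_packing /graphs_le /= -/(common_size s) complete_common_size.
  by rewrite leqNgt rC.
have ex : exists m : nat, `[< A m%:Z%R >].
  exists 0; apply/asboolP => G _; rewrite lez_nat leqn0 finset.cards_eq0 => /eqP G0.
  by exists 1%g; rewrite /near_packing /graphs_le /= G0 finset.set0I finset.cards0.
have ubn (m : nat) : `[< A m%:Z%R >] -> m <= 'C(n, 2).
  by move=> /asboolP /ub; rewrite lez_nat.
case: (ex_maxnP ex ubn) => m /asboolP Am mmax; exists m%:Z%R; split => // -[p|p] Ap //.
by rewrite lez_nat; apply: mmax; apply/asboolP.
Qed.

(* Main.v *)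
(** The lower bound is proved by induction on the order [n]. If [m ^ 2 < 2 n (n - 1)], a uniformly
    random permutation has fewer than four common edges on average. Otherwise [n] is large; call hubs
    the [h] vertices of degree at least [D], where [D] is about [sqrt n / 2]. Since [2 n - m] is at
    least [10 n ^ (2/3)], many non-hubs [x] have [2 tau x + rho x <= 3], where [tau x] and [rho x]
    count the neighbours of [x] that are hubs and non-hubs. Two leaves at different hubs, or [2 k]
    pairwise non-adjacent vertices of degree [k], [k = 2, 3], with disjoint neighbourhoods, can be
    deleted and put back without creating a common edge. If no such deletion is possible, almost all
    these [x] hang on at most four hubs, so some hub [a] has a pool of at least [2 h + D - 1]
    vertices whose only possible hub neighbour is [a] and which have at most one other neighbour.
    Exchange every hub with a pool vertex, and every non-hub neighbour of the latter with another
    pool vertex: this creates at most three common edges, all of them close to [a] and its partner.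
    The remaining vertices have degree less than [D], and none of them is adjacent to the partner
    of a hub, so an exchange argument in the style of Sauer and Spencer places them without any
    further common edge.

    The upper bound comes from the complete bipartite graph [K_(2, n - 2)]. *)
Require Import Defs.
From mathcomp Require Import all_boot all_fingroup.
From mathcomp Require Import zify.

Set Implicit Arguments.
Unset Strict Implicit.
Unset Printing Implicit Defensive.

(** * The exchange argument *)

Section Swap.
Variables (V : finType) (e : rel V).
Hypotheses (es : symmetric e) (ei : irreflexive e).

Definition nbr (x : V) : {set V} := [set y | e x y].
Definition conf (s : {perm V}) : rel V := fun x y => e x y && e (s x) (s y).
(* Common edges are counted as ordered pairs, hence twice; so are edges in [arcs] below. *)
Definition confs (s : {perm V}) : {set V * V} := [set p | conf s p.1 p.2].

Lemma in_nbr x y : (y \in nbr x) = e x y. Proof. by rewrite inE. Qed.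

Lemma confC s x y : conf s x y = conf s y x.
Proof. by rewrite /conf es (es (s x)). Qed.

(** By finiteness the injection [s0] permutes [T], hence also its complement; [s] then permutes the
    complement, and therefore [T]. *)
Lemma perm_off_stable (s0 s : {perm V}) (T : {set V}) :
  {in T, forall x, s0 x \in T} -> (forall x, x \notin T -> s x = s0 x) ->
  forall x, (s x \in T) = (x \in T).
Proof.
move=> st0 ag.
have st0' x : (s0 x \in T) = (x \in T).
  have sub : s0 @: T \subset T by apply/subsetP => _ /imsetP[y yT ->]; exact: st0.
  have /eqP E : s0 @: T == T by rewrite eqEcard sub (card_imset _ (@perm_inj _ s0)) /=.
  by rewrite -{1}E mem_imset //; exact: perm_inj.
have offT : {in ~: T, forall x, s x \in ~: T}.
  by move=> x; rewrite !inE => xT; rewrite ag // st0'.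
have sub : s @: (~: T) \subset ~: T by apply/subsetP => _ /imsetP[y yT ->]; exact: offT.
have /eqP E : s @: (~: T) == ~: T by rewrite eqEcard sub (card_imset _ (@perm_inj _ s)) /=.
move=> x; have: (s x \in ~: T) = (x \in ~: T).
  by rewrite -{1}E mem_imset //; exact: perm_inj.
by rewrite !inE => /negb_inj.
Qed.

(** The transposition acts first, so [v] and [w] exchange their images. The assumptions leave no
    conflict at [v] or [w] except possibly the pair [vw], whose status does not change; pairs
    avoiding both are untouched, and the conflict [vu] disappears. *)
Lemma swap_conf (s : {perm V}) v w u :
  conf s v u -> w != u ->
  (forall y, e v y -> ~~ e (s w) (s y)) -> (forall y, e w y -> ~~ e (s v) (s y)) ->
  (confs (tperm v w * s)%g \proper confs s).
Proof.
move=> cvu wu b1 b2; set t := (tperm v w * s)%g.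
have wv : w != v.
  by apply: contraTneq cvu => E; rewrite /conf; apply/negP => /andP[/b1]; rewrite E => /negP.
have tE x : t x = s (tperm v w x) by rewrite permM.
have tv y : y != v -> y != w -> t y = s y by move=> yv yw; rewrite tE tpermD // eq_sym.
have vy y : y != w -> ~~ conf t v y.
  move=> yw; apply/negP => /andP[vy]; have yv : y != v by apply: contraTneq vy => ->; rewrite ei.
  by rewrite tE tpermL tv // => h; move: (b1 _ vy); rewrite h.
have wy y : y != v -> ~~ conf t w y.
  move=> yv; apply/negP => /andP[wy]; have yw : y != w by apply: contraTneq wy => ->; rewrite ei.
  by rewrite tE tpermR tv // => h; move: (b2 _ wy); rewrite h.
have vw : conf t v w = conf s v w by rewrite /conf !tE tpermL tpermR (es (s w)).
apply/properP; split; last first.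
  exists (v, u); rewrite inE //=; apply: vy; by rewrite eq_sym.
apply/subsetP => -[x y]; rewrite !inE /= => c.
have [xv|xv] := eqVneq x v.
  have [yw|yw] := eqVneq y w; first by rewrite xv yw -vw -xv -yw.
  by move: (vy _ yw); rewrite -xv c.
have [xw|xw] := eqVneq x w.
  have [yv|yv] := eqVneq y v; first by rewrite confC xw yv -vw -xw -yv confC.
  by move: (wy _ yv); rewrite -xw c.
have [yv|yv] := eqVneq y v; first by move: (vy _ xw); rewrite confC -yv c.
have [yw|yw] := eqVneq y w; first by move: (wy _ xv); rewrite confC -yw c.
by move: c; rewrite /conf !tv.
Qed.

Lemma card_bigcup_le (I : finType) (A : {set I}) (F : I -> {set V}) c :
  {in A, forall i, #|F i| <= c} -> #|\bigcup_(i in A) F i| <= #|A| * c.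
Proof.
move=> Fc; apply: (@leq_trans (\sum_(i in A) #|F i|)).
  elim/big_rec2: _ => [|i n B _ le]; first by rewrite cards0.
  by apply: leq_trans (leq_add (leqnn _) le); rewrite cardsU leq_subr.
by rewrite -sum_nat_const; apply: leq_sum.
Qed.

(* Among the permutations that agree with [s0] off [T], take one with the fewest conflicts. If
   [v] in [T] lies on a conflict, fewer than [2 d c] vertices [w] fail to make the exchange of the
   images of [v] and [w] an improvement. *)
Lemma swap_packing (s0 : {perm V}) (T : {set V}) (d c : nat) :
  {in T, forall x, s0 x \in T} ->
  {in T, forall x, #|nbr x| <= d} -> {in T, forall x, #|nbr x :&: T| <= c} ->
  (forall v u, v \in T -> u \notin T -> e v u -> #|nbr (s0 u) :&: T| <= c) ->
  (forall v u, v \in T -> u \notin T -> e v u -> #|nbr ((s0^-1)%g u) :&: T| <= c) ->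
  (forall v u, v \in T -> e v u -> 2 * (d * c) <= #|T :\ u|) ->
  exists2 s : {perm V}, forall x, x \notin T -> s x = s0 x &
    forall v u, v \in T -> ~~ conf s v u.
Proof.
move=> st dT cT c0 c0' big.
pose P (s : {perm V}) := [forall x, (x \notin T) ==> (s x == s0 x)].
have P0 : P s0 by apply/forallP => x; rewrite eqxx implybT.
case: (arg_minnP (fun s => #|confs s|) P0) => s /forallP Ps smin.
have ag x : x \notin T -> s x = s0 x by move=> xT; apply/eqP; move: (Ps x); rewrite xT.
have sT := perm_off_stable st ag.
exists s => // v u vT; apply/negP => cvu.
have [evu esvu] := andP cvu.
(* [b1] and [b2] collect the [w] in [T] that violate the first and the second assumption of
   [swap_conf]. *)
pose b1 := \bigcup_(y in nbr v) ((s^-1)%g @: (nbr (s y) :&: T)).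
pose b2 := \bigcup_(y in nbr (s v)) (nbr ((s^-1)%g y) :&: T).
have cardle (A : {set V}) B : #|A| <= d -> #|A| * B <= d * B by move=> h; rewrite leq_mul2r h orbT.
have b1c : #|b1| <= d * c.
  apply: leq_trans (cardle _ _ (dT _ vT)); apply: card_bigcup_le => y.
  rewrite in_nbr => vy; rewrite card_imset; last exact: perm_inj.
  case: (boolP (y \in T)) => yT; first by apply: cT; rewrite sT.
  by rewrite ag //; apply: c0 vy.
have b2c : #|b2| <= d * c.
  have svT : s v \in T by rewrite sT.
  apply: leq_trans (cardle _ _ (dT _ svT)); apply: card_bigcup_le => y.
  rewrite in_nbr => vy.
  case: (boolP (y \in T)) => yT; first by apply: cT; rewrite -sT permKV.
  have -> : (s^-1)%g y = (s0^-1)%g y.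
    by apply: (@perm_inj _ s0); rewrite permKV -ag ?permKV // -sT permKV.
  by apply: c0' vy.
have vb1 : v \in b1.
  apply/bigcupP; exists u; rewrite ?in_nbr //; apply/imsetP; exists (s v); rewrite ?permK //.
  by rewrite !inE sT vT es esvu.
have vb2 : v \in b2.
  by apply/bigcupP; exists (s u); rewrite ?in_nbr // permK !inE vT es evu.
(* The conflict with [u] puts [v] in both sets, so the bound on the union is strict and a good [w]
   remains in [T :\ u]. *)
have ub : #|b1 :|: b2| < 2 * (d * c).
  have: 0 < #|b1 :&: b2| by apply/card_gt0P; exists v; rewrite inE vb1.
  have := subset_leq_card (subsetIl b1 b2); rewrite cardsU; lia.
have [w wTu wb] : exists2 w, w \in T :\ u & w \notin b1 :|: b2.
  apply/subsetPn; apply/negP => /subset_leq_card; have := big _ _ vT evu; lia.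
move: wTu wb; rewrite !inE negb_or => /andP[wu wT] /andP[wb1 wb2].
have := swap_conf cvu wu.
have sub1 y : e v y -> ~~ e (s w) (s y).
  move=> vy; apply: contra wb1 => swy; apply/bigcupP; exists y; rewrite ?in_nbr //.
  by apply/imsetP; exists (s w); rewrite ?permK // !inE sT wT es swy.
have sub2 y : e w y -> ~~ e (s v) (s y).
  move=> wy; apply: contra wb2 => svy; apply/bigcupP; exists (s y); rewrite ?in_nbr //.
  by rewrite permK !inE wT es wy.
move=> /(_ sub1 sub2) /proper_card; rewrite ltnNge smin //.
apply/forallP => x; apply/implyP => xT; rewrite permM tpermD ?ag //.
  by apply: contraNneq xT => <-.
by apply: contraNneq xT => <-.
Qed.

End Swap.

(** * Random permutations *)

Definition arcs (V : finType) (e : rel V) : {set V * V} := [set p | e p.1 p.2].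

Lemma perm_on_tperm (V : finType) (W : {set V}) x y :
  x \in W -> y \in W -> perm_on W (tperm x y).
Proof.
by move=> xW yW; apply/subsetP => z; rewrite inE; apply: contraR => zW;
   rewrite tpermD //; apply: contraNneq zW => <-.
Qed.

Lemma card_offdiag (V : finType) (W : {set V}) :
  #|[set p : V * V | [&& p.1 \in W, p.2 \in W & p.1 != p.2]]| = #|W| * #|W|.-1.
Proof.
rewrite -sum1_card (partition_big fst (mem W)) /=; last by move=> p; rewrite inE => /andP[].
rewrite -sum_nat_const; apply: eq_bigr => x xW.
rewrite (cardsD1 x W) xW /= -sum1_card.
rewrite (reindex (fun y => (x, y))) /=; last first.
  by exists snd => //= -[a b]; rewrite !inE /= => /andP[_ /eqP ->].
by apply: eq_bigl => y; rewrite !inE /= xW eqxx andbT /= eq_sym andbC.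
Qed.

Section Average.
Variables (V : finType) (W : {set V}).

Let P : {set {perm V}} := [set s | perm_on W s].
Let fib (p q : V * V) : {set {perm V}} := [set s in P | (s p.1, s p.2) == q].
Let off : {set V * V} := [set p | [&& p.1 \in W, p.2 \in W & p.1 != p.2]].

(** [t] sends [x] to [x']; a second transposition sends [t y] to [y'] and fixes [x']. *)
Lemma perm_on_2transitive p q : p \in off -> q \in off ->
  exists2 r, perm_on W r & (r p.1, r p.2) = q.
Proof.
case: p => x y; case: q => x' y'; rewrite !inE /= => /and3P[xW yW xy] /and3P[xW' yW' xy'].
pose t := tperm x x'; have tW : perm_on W t by exact: perm_on_tperm.
exists (t * tperm (t y) y')%g.
  by apply: perm_onM => //; apply: perm_on_tperm => //; rewrite perm_closed.
rewrite !permM tpermL [t x]tpermL tpermD ?(eq_sym _ x') //.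
by apply: contraNneq xy; rewrite -{1}(tpermL x x') => /perm_inj ->.
Qed.

(** Right multiplication by a suitable [r] carries any fibre over [off] into any other, so these
    fibres have equal size; they partition [P]. *)
Lemma card_fib p q : p \in off -> q \in off -> #|fib p q| * #|off| = #|P|.
Proof.
move=> po qo.
have le q1 q2 : q1 \in off -> q2 \in off -> #|fib p q1| <= #|fib p q2|.
  move=> o1 o2; have [r rW rq] := perm_on_2transitive o1 o2.
  rewrite -(card_imset _ (@mulIg _ r)); apply/subset_leq_card/subsetP => _ /imsetP[s + ->].
  rewrite !inE => /andP[sW /eqP sq]; rewrite perm_onM //= !permM -rq -sq //=.
rewrite -[RHS]sum1_card (partition_big (fun s : {perm V} => (s p.1, s p.2)) (mem off)) /=.
  rewrite mulnC -sum_nat_const; apply: eq_bigr => q' qo'.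
  have -> : #|fib p q| = #|fib p q'| by apply/eqP; rewrite eqn_leq !le.
  by rewrite -sum1_card; apply: eq_bigl => s; rewrite !inE.
move=> s; rewrite !inE /= => sW; rewrite !perm_closed // (inj_eq (@perm_inj _ s)).
by move: po; rewrite inE.
Qed.

(** First moment: a random permutation of [W] maps a given arc to a given arc with probability
    [1 / (#|W| * #|W|.-1)], so by assumption the expected number of conflicts is below [b]. *)
Lemma exists_few_conf (e : rel V) (b : nat) :
  symmetric e -> irreflexive e -> (forall x y, e x y -> x \in W) ->
  #|arcs e| * #|arcs e| < b * (#|W| * #|W|.-1) ->
  exists2 s, perm_on W s & #|confs e s| < b.
Proof.
move=> es ei supp lt.
suff /existsP[s /andP[sW sb]] : [exists s, perm_on W s && (#|confs e s| < b)] by exists s.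
apply: contraLR lt => /existsPn big.
have arc_off p : p \in arcs e -> p \in off.
  case: p => x y; rewrite !inE /= => exy; rewrite (supp _ _ exy) (supp y x) 1?es //=.
  by apply: contraTneq exy => ->; rewrite ei.
have P0 : 0 < #|P| by apply/card_gt0P; exists 1%g; rewrite inE perm_on1.
(* Both sides count the triples [(s, p, q)] such that [s] maps the arc [p] to the arc [q]. *)
have sumE : \sum_(s in P) #|confs e s| = \sum_(p in arcs e) \sum_(q in arcs e) #|fib p q|.
  have fibE p q : #|fib p q| = \sum_(s in P) ((s p.1, s p.2) == q).
    rewrite -sum1_card big_mkcond [RHS]big_mkcond /=.
    by apply: eq_bigr => s _; rewrite !inE; case: (perm_on W s) => //=; case: eqP.
  under [RHS]eq_bigr do under eq_bigr do rewrite fibE.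
  under [RHS]eq_bigr do rewrite exchange_big /=.
  rewrite exchange_big /=; apply: eq_bigr => s _.
  rewrite -sum1_card big_mkcond [RHS]big_mkcond; apply: eq_bigr => p _.
  rewrite !inE /conf; case: (e p.1 p.2) => //=.
  have [sp|sp] := boolP ((s p.1, s p.2) \in arcs e).
    rewrite (bigD1 _ sp) /= eqxx big1 ?addn0; first by move: sp; rewrite inE => ->.
    by move=> q /andP[_]; rewrite eq_sym => /negbTE ->.
  rewrite big1; first by move: sp; rewrite inE => /negbTE ->.
  by move=> q qa; case: eqP => // E; rewrite E qa in sp.
rewrite -leqNgt -(leq_pmul2r P0) -card_offdiag -/off.
have -> : #|arcs e| * #|arcs e| * #|P| = (\sum_(s in P) #|confs e s|) * #|off|.
  rewrite sumE big_distrl /= -mulnA -sum_nat_const; apply: eq_bigr => p pa.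
  rewrite big_distrl /= -sum_nat_const; apply: eq_bigr => q qa.
  by rewrite card_fib // arc_off.
rewrite mulnAC leq_mul2r; apply/orP; right.
rewrite mulnC -sum_nat_const; apply: leq_sum => s; rewrite inE => sP.
by move: (big s); rewrite sP /= -leqNgt.
Qed.

End Average.

(** * Exchanging hubs with pool vertices *)

Lemma subset_of_card (T : finType) (B : {set T}) k :
  k <= #|B| -> exists2 A : {set T}, A \subset B & #|A| = k.
Proof.
move=> kB; exists [set x in take k (enum B)].
  by apply/subsetP => x; rewrite inE => /mem_take; rewrite mem_enum.
rewrite cardsE (card_uniqP _) ?take_uniq ?enum_uniq // size_takel //.
by rewrite -cardE.
Qed.

Section Selection.
Variables (V : finType) (e : rel V) (R Q : {set V}) (d h : nat).
Hypotheses (es : symmetric e) (ei : irreflexive e).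
Hypotheses (QR : Q \subset R) (Q1 : {in Q, forall x, #|nbr e x :&: R| <= 1}).
Hypotheses (Rd : {in R, forall z, #|nbr e z| <= d}) (Qh : 2 * h + d <= #|Q|).

Lemma pool_nbr_eq x y z : x \in Q -> y \in R -> z \in R -> e x y -> e x z -> y = z.
Proof.
move=> xQ yR zR xy xz; move/card_le1_eqP: (Q1 xQ) => h1.
by apply: h1; rewrite !inE ?yR ?zR ?andbT.
Qed.

(* The hubs are to be exchanged with [L], and [Z1] with [X], while [Z2], the neighbours of [L] inside
   the pool [Q], is to be kept fixed. *)
Definition swap_selection (L X Z1 Z2 : {set V}) :=
  [/\ [/\ L \subset Q, X \subset Q, [disjoint L & X] &
        {in L :|: X &, forall x y, ~~ e x y}],
      [/\ #|L| = h, #|Z1| = #|X| & #|Z1| + #|Z2| <= h],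
      [/\ Z1 \subset R :\: Q, Z2 \subset Q :\: (L :|: X) &
        {in L, forall x, nbr e x :&: R \subset Z1 :|: Z2}],
      forall x z, x \in X -> z \in Z1 -> ~~ e x z &
      {in Z2, forall z, nbr e z :&: R \subset L}].

(** Split [Q] into a maximal independent set [Q0] and the rest [E]. Take a smallest [Zm] outside [Q]
    such that at least [h] vertices of [Q0] have all their neighbours in [R] inside [E :|: Zm], and
    choose [L] among these. Minimality of [Zm] keeps it small enough for the remaining vertices of
    [Q0] to supply [X]. *)
Lemma exists_swap_selection : exists L X Z1 Z2, swap_selection L X Z1 Z2.
Proof.
have inR x : x \in Q -> x \in R by move/(subsetP QR).
pose ind (A : {set V}) := (A \subset Q) && [forall x in A, forall y in A, ~~ e x y].
have ind0 : ind set0 by rewrite /ind sub0set; apply/forall_inP => x; rewrite inE.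
case: (arg_maxnP (fun A : {set V} => #|A|) ind0) => Q0 /andP[Q0Q /forall_inP Q0i] Q0max.
have Q0e x y : x \in Q0 -> y \in Q0 -> ~~ e x y by move=> /Q0i/forall_inP; apply.
have inQ x : x \in Q0 -> x \in Q by move/(subsetP Q0Q).
pose E := Q :\: Q0.
have Epart x : x \in E -> exists2 y, y \in Q0 & e x y.
  rewrite inE => /andP[xQ0 xQ]; apply/exists_inP; apply: contraR xQ0 => /exists_inPn xind.
  have: ind (x |: Q0).
    rewrite /ind subUset sub1set xQ Q0Q /=; apply/forall_inP => u; rewrite !inE => uQ0.
    apply/forall_inP => v; rewrite !inE => vQ0.
    case/orP: uQ0 => [/eqP ->|uQ0]; case/orP: vQ0 => [/eqP ->|vQ0].
    - by rewrite ei.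
    - exact: xind.
    - by rewrite es; exact: xind.
    - exact: Q0e.
  move/Q0max; rewrite cardsU1; case: (x \in Q0) => //=; lia.
pose g (Z : {set V}) := [set x in Q0 | nbr e x :&: R \subset E :|: Z].
(* By maximality a vertex of [E] has a neighbour in [Q0]. That neighbour has no other neighbour in
   [R], so it lies in [g set0] and serves only one vertex of [E]. *)
have Eg : #|E| <= #|g set0|.
  rewrite -[X in _ <= X]muln1; apply: leq_trans (card_bigcup_le (F := fun y => nbr e y :&: R) _).
    apply/subset_leq_card/subsetP => x xE; have [y yQ0 xy] := Epart _ xE.
    have xR : x \in R by apply: inR; move: xE; rewrite inE => /andP[].
    apply/bigcupP; exists y; last by rewrite !inE es xy.
    rewrite inE yQ0 setU0; apply/subsetP => z; rewrite !inE => /andP[yz zR].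
    rewrite (pool_nbr_eq (inQ _ yQ0) zR xR yz) 1?es //.
    by move: xE; rewrite inE.
  by move=> y; rewrite inE => /andP[/inQ/Q1].
have gQ0 Z : g Z \subset Q0 by apply/subsetP => x; rewrite inE => /andP[].
have QE : #|Q| = #|Q0| + #|E| by rewrite cardsD (setIidPr Q0Q); have := subset_leq_card Q0Q; lia.
pose P (Z : {set V}) := (Z \subset R :\: Q) && (h <= #|g Z|).
(* Here [g] is all of [Q0], and [#|E| <= #|g set0| <= #|Q0|] gives [2 * #|Q0| >= #|Q| >= 2 * h]. *)
have PR : P (R :\: Q).
  rewrite /P subxx /=; have -> : g (R :\: Q) = Q0.
    apply/eqP; rewrite eqEsubset gQ0; apply/subsetP => x xQ0; rewrite inE xQ0 /=.
    apply/subsetP => y; rewrite !inE => /andP[xy yR]; rewrite yR andbT.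
    have -> : y \notin Q0 by apply: contraTN xy => yQ0; apply: Q0e.
    by case: (y \in Q).
  by have := subset_leq_card (gQ0 set0); lia.
case: (arg_minnP (fun A : {set V} => #|A|) PR) => Zm /andP[ZmR Zmh] Zmmin.
have ZmQ z : z \in Zm -> z \notin Q by move/(subsetP ZmR); rewrite inE => /andP[].
have ZmR' z : z \in Zm -> z \in R by move/(subsetP ZmR); rewrite inE => /andP[].
have ZmE z : z \in Zm -> z \notin E by move/ZmQ; apply: contra; rewrite inE => /andP[].
have less z : z \in Zm -> #|g (Zm :\ z)| < h.
  move=> zZ; rewrite ltnNge; apply/negP => hz.
  have /Zmmin : P (Zm :\ z) by rewrite /P hz (subset_trans (subD1set _ _)).
  by rewrite (cardsD1 z Zm) zZ; lia.
(* Dropping some [z0] from [Zm] removes at most [d] vertices from [g Zm], its neighbours, and leaves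
   fewer than [h]. By minimality every other [z] in [Zm] is the only neighbour in [R] of some vertex
   of [g Zm], which is then outside [g set0]. So [#|Zm| <= h - #|E|], while [Q0 :\: g Zm] has more
   than [h - #|E|] elements. *)
have Zmcard : #|Zm| <= #|Q0 :\: g Zm|.
  have [->|[z0 z0Z]] := set_0Vmem Zm; first by rewrite cards0.
  have gle : #|g Zm| <= #|g (Zm :\ z0)| + d.
    apply: leq_trans (leq_add (leqnn _) (Rd (ZmR' _ z0Z))).
    apply: leq_trans (leq_card_setU _ _); apply/subset_leq_card/subsetP => x.
    rewrite !inE => /andP[xQ0 /subsetP sub]; rewrite xQ0 /=.
    have [//|xz0] := boolP (e z0 x); first by rewrite orbT.
    rewrite orbF; apply/subsetP => y yN; have := sub _ yN; rewrite !inE.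
    case: eqVneq => [yz0|//]; move: yN; rewrite inE in_nbr yz0 => /andP[].
    by rewrite es (negbTE xz0).
  have Zle : #|Zm :\ z0| <= #|g (Zm :\ z0) :\: g set0|.
    rewrite -[X in _ <= X]muln1; apply: leq_trans (card_bigcup_le (F := fun y => nbr e y :&: R) _).
      apply/subset_leq_card/subsetP => z; rewrite !inE => /andP[zz0 zZ].
      have /subsetPn[x] : ~~ (g Zm \subset g (Zm :\ z)).
        by apply/negP => /subset_leq_card; have := less _ zZ; lia.
      rewrite !inE => /andP[xQ0 /subsetP sub]; rewrite xQ0 /= => /subsetPn[y yN].
      have := sub _ yN; rewrite inE in_nbr in yN; case/andP: yN => xy yR.
      rewrite !in_setU in_setD1 negb_or => + /andP[nE]; rewrite (negbTE nE) /= => yZ.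
      rewrite yZ andbT negbK => /eqP yz; rewrite {y nE yR}yz in xy yZ *.
      apply/bigcupP; exists x; last by rewrite !inE xy ZmR'.
      have zR := ZmR' _ zZ; have zE := ZmE _ zZ.
      rewrite !inE xQ0 /= setU0; apply/andP; split.
        by apply/subsetPn; exists z; rewrite // inE in_nbr xy zR.
      apply/subsetP => y; rewrite inE in_nbr => /andP[xy' yR].
      by rewrite (pool_nbr_eq (inQ _ xQ0) yR zR xy' xy) !inE zz0 zZ orbT.
    by move=> y; rewrite !inE => /andP[_ /andP[/inQ/Q1]].
  have g0 : g set0 \subset g (Zm :\ z0).
    apply/subsetP => x; rewrite !inE setU0 => /andP[-> /= sub].
    by apply: subset_trans sub (subsetUl _ _).
  have := less _ z0Z; have := cardsD (g (Zm :\ z0)) (g set0); rewrite (setIidPr g0).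
  have := cardsD Q0 (g Zm); rewrite (setIidPr (gQ0 _)).
  have := subset_leq_card (gQ0 Zm); have := subset_leq_card g0; have := cardsD1 z0 Zm; rewrite z0Z.
  lia.
have [L LgZ Lh] := subset_of_card Zmh.
have LQ0 : L \subset Q0 := subset_trans LgZ (gQ0 _).
pose Z := \bigcup_(x in L) (nbr e x :&: R).
have ZsubE : Z \subset E :|: Zm.
  by apply/bigcupsP => x /(subsetP LgZ); rewrite inE => /andP[].
have Zh : #|Z| <= h.
  rewrite -Lh -[X in _ <= X]muln1; apply: card_bigcup_le => x /(subsetP LQ0)/inQ; exact: Q1.
have ZQ z : z \in Z :\: Q -> z \in Zm.
  by rewrite inE => /andP[zQ /(subsetP ZsubE)]; rewrite !inE (negbTE zQ) andbF.
have XZ : #|Z :\: Q| <= #|Q0 :\: g Zm|.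
  by apply: leq_trans Zmcard; apply/subset_leq_card/subsetP.
(* A vertex outside [g Zm] has a neighbour in [R] outside [E :|: Zm]; this is its only one, so it is
   adjacent to nothing in [Zm]. *)
have [X Xg XZ1] := subset_of_card XZ.
have XQ0 : X \subset Q0 := subset_trans Xg (subsetDl _ _).
have LXQ0 : L :|: X \subset Q0 by rewrite subUset LQ0.
exists L, X, (Z :\: Q), (Z :&: Q); split; [split|split|split| |] => //.
- exact: subset_trans LQ0 Q0Q.
- exact: subset_trans XQ0 Q0Q.
- rewrite disjoint_sym; apply/pred0P => x /=; apply/negP => /andP[/(subsetP Xg)].
  by rewrite inE => /andP[xg _] /(subsetP LgZ); apply/negP.
- by move=> x y /(subsetP LXQ0) xQ /(subsetP LXQ0) yQ; apply: Q0e.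
- by rewrite addnC cardsID.
- by apply: setSD; apply/bigcupsP => x _; apply: subsetIr.
- apply/subsetP => z; rewrite in_setI => /andP[/(subsetP ZsubE)]; rewrite in_setU => zE zQ.
  have: z \in E by case/orP: zE => // /ZmQ; rewrite zQ.
  rewrite inE => /andP[zQ0 _]; rewrite inE zQ andbT.
  by apply: contra zQ0 => /(subsetP LXQ0).
- by move=> x xL; rewrite setUC setID; apply: (bigcup_sup x).
- move=> x z xX /ZQ zZm; have := subsetP Xg _ xX; rewrite !inE => /andP[+ xQ0].
  rewrite xQ0 /=; apply: contra => xz; apply/subsetP => y; rewrite inE in_nbr => /andP[xy yR].
  by rewrite (pool_nbr_eq (inQ _ xQ0) yR (ZmR' _ zZm) xy xz) !inE zZm orbT.
- move=> z; rewrite inE => /andP[/bigcupP[x xL]]; rewrite inE in_nbr => /andP[xz zR] zQ.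
  have xQ := inQ _ (subsetP LQ0 _ xL).
  apply/subsetP => y; rewrite inE in_nbr => /andP[zy yR].
  by rewrite (pool_nbr_eq zQ yR (inR _ xQ) zy) // es.
Qed.

End Selection.

(** The elements of equal index in [enum A] and [enum B] are exchanged. *)
Lemma exists_swap_perm (T : finType) (A B : {set T}) :
  [disjoint A & B] -> #|A| = #|B| ->
  exists s : {perm T}, [/\ involutive s, forall x, (s x \in A) = (x \in B),
    forall x, (s x \in B) = (x \in A) & forall x, x \notin A -> x \notin B -> s x = x].
Proof.
move=> dAB cAB.
pose g (A B : {set T}) x := nth x (enum B) (index x (enum A)).
have idx (C D : {set T}) x : #|C| = #|D| -> x \in C -> index x (enum C) < size (enum D).
  by move=> cC xC; rewrite -cardE -cC cardE index_mem mem_enum.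
have gB (C D : {set T}) x : #|C| = #|D| -> x \in C -> g C D x \in D.
  by move=> cC xC; rewrite -mem_enum mem_nth // idx.
have gK (C D : {set T}) x : #|C| = #|D| -> x \in C -> g D C (g C D x) = x.
  move=> cC xC; rewrite /g index_uniq ?enum_uniq ?idx //.
  by rewrite (set_nth_default x) ?nth_index ?mem_enum // index_mem mem_enum.
have nAB x : x \in A -> x \in B = false by move=> xA; rewrite (disjointFr dAB).
have nBA x : x \in B -> x \in A = false by move=> xB; rewrite (disjointFl dAB).
pose f x := if x \in A then g A B x else if x \in B then g B A x else x.
have fK : involutive f.
  move=> x; have [xA|xA] := boolP (x \in A).
    have fx : f x = g A B x by rewrite /f xA.
    by rewrite fx /f (nBA _ (gB _ _ _ cAB xA)) gB // gK.
  have [xB|xB] := boolP (x \in B).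
    have fx : f x = g B A x by rewrite /f (negbTE xA) xB.
    by rewrite fx /f (gB _ _ _ (esym cAB) xB) gK.
  have fx : f x = x by rewrite /f (negbTE xA) (negbTE xB).
  by rewrite fx fx.
have fA x : x \in A -> f x \in B by move=> xA; rewrite /f xA gB.
have fB x : x \in B -> f x \in A by move=> xB; rewrite /f (nBA _ xB) xB gB.
exists (perm (inv_inj fK)); split.
- by move=> x; rewrite !permE fK.
- move=> x; rewrite permE; apply/idP/idP => [/fA|/fB //]; by rewrite fK.
- move=> x; rewrite permE; apply/idP/idP => [/fB|/fA //]; by rewrite fK.
- by move=> x xA xB; rewrite permE /f (negbTE xA) (negbTE xB).
Qed.

Section Construction.
Variables (V : finType) (e : rel V) (W H Q : {set V}) (a : V) (d : nat).
Hypotheses (es : symmetric e) (ei : irreflexive e).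
Hypotheses (supp : forall x y, e x y -> x \in W) (HW : H \subset W) (aH : a \in H).
Hypotheses (QR : Q \subset W :\: H).
Hypotheses (Qa : forall x b, x \in Q -> b \in H -> e x b -> b = a).
Hypotheses (Q1 : {in Q, forall x, #|nbr e x :&: (W :\: H)| <= 1}).
Hypotheses (d0 : 0 < d) (Rd : {in W :\: H, forall z, #|nbr e z| <= d}).
Hypotheses (Qh : 2 * #|H| + d <= #|Q|) (Wh : 2 * (d * d) + 4 * #|H| < #|W|).

(** Let [s0] exchange [H] with [L] and [Z1] with [X]. Since [L :|: X] is independent and pool
    vertices have no hub neighbour but [a], conflicts between vertices outside [T] occur only at [a]
    or its partner [p]. The exchange argument then rearranges [T] without conflicts. The bound 6 is
    three edges in both orders. *)
Lemma near_packing_of_pool : exists2 s, perm_on W s & #|confs e s| <= 6.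
Proof.
have [L [X [Z1 [Z2]]]] := exists_swap_selection es ei QR Q1 Rd Qh.
case=> [[LQ XQ dLX ind] [Lh Z1X Zh] [Z1R Z2Q NL] XZ1 NZ2].
set R := W :\: H in Z1R NL NZ2 *.
have LXQ x : x \in L :|: X -> x \in Q.
  by rewrite inE => /orP[/(subsetP LQ)|/(subsetP XQ)].
have LQ' x : x \in L -> x \in Q by move/(subsetP LQ).
have XQ' x : x \in X -> x \in Q by move/(subsetP XQ).
have QR' x : x \in Q -> x \in R by move/(subsetP QR).
have Z1R' x : x \in Z1 -> x \in R by move/(subsetP Z1R); rewrite inE => /andP[].
have Z1Q x : x \in Z1 -> x \notin Q by move/(subsetP Z1R); rewrite inE => /andP[].
have Z2Q' x : x \in Z2 -> x \in Q by move/(subsetP Z2Q); rewrite inE => /andP[].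
have Z2L x : x \in Z2 -> x \notin L.
  by move/(subsetP Z2Q); rewrite !inE negb_or => /andP[/andP[]].
have Z2X x : x \in Z2 -> x \notin X.
  by move/(subsetP Z2Q); rewrite !inE negb_or => /andP[/andP[]].
have RH x : x \in R -> x \notin H by rewrite inE => /andP[].
have RW x : x \in R -> x \in W by rewrite inE => /andP[].
have HR x : x \in H -> x \notin R by move=> xH; rewrite inE xH.
have LX x : x \in L -> x \notin X by move=> xL; rewrite (disjointFr dLX).
have dHL : [disjoint H & L].
  by apply/pred0P => x /=; apply/negP => /andP[xH /LQ'/QR'/RH]; rewrite xH.
have dZX : [disjoint Z1 & X].
  by apply/pred0P => x /=; apply/negP => /andP[/Z1Q xQ /XQ']; apply/negP.
have [s1 [s1K s1H s1L s1E]] := exists_swap_perm dHL (esym Lh).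
have [s2 [s2K s2Z s2X s2E]] := exists_swap_perm dZX Z1X.
(* The involutions [s1] and [s2] move disjoint sets of vertices, so they glue to one involution. *)
pose f x := if (x \in H) || (x \in L) then s1 x else s2 x.
have fK : involutive f.
  move=> x; have [xHL|xHL] := boolP ((x \in H) || (x \in L)).
    have fx : f x = s1 x by rewrite /f xHL.
    by rewrite fx /f s1H s1L orbC xHL s1K.
  have fx : f x = s2 x by rewrite /f (negbTE xHL).
  rewrite fx /f; case: ifP => [s2HL|_]; last by rewrite s2K.
  case: (boolP ((x \in Z1) || (x \in X))) => xZX.
    have: (s2 x \in Z1) || (s2 x \in X) by rewrite s2Z s2X orbC.
    case/orP: s2HL => [sH|sL].
      by case/orP => [/Z1R'|/XQ'/QR'] /RH; rewrite sH.
    by case/orP => [/Z1Q|]; rewrite ?(LQ' _ sL) // (negbTE (LX _ sL)).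
  move: xZX; rewrite negb_or => /andP[xZ xX]; move: s2HL xHL.
  by rewrite s2E // => ->.
pose s0 : {perm V} := perm (inv_inj fK).
have s0K : involutive s0 by move=> x; rewrite !permE fK.
have s0V x : (s0^-1)%g x = s0 x by apply: (@perm_inj _ s0); rewrite permKV s0K.
have s0H x : x \in H -> s0 x \in L by move=> xH; rewrite permE /f xH /= s1L.
have s0L x : x \in L -> s0 x \in H by move=> xL; rewrite permE /f xL orbT s1H.
have ZXn x : x \in Z1 \/ x \in X -> (x \in H) || (x \in L) = false.
  case=> [xZ|xX]; apply/negbTE; rewrite negb_or.
    by rewrite RH ?Z1R' //=; apply: contra (Z1Q _ xZ) => /LQ'.
  by rewrite RH ?QR' ?XQ' //=; apply/negP => /LX; rewrite xX.
have s0Z x : x \in Z1 -> s0 x \in X by move=> xZ; rewrite permE /f ZXn ?s2X //; left.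
have s0X x : x \in X -> s0 x \in Z1 by move=> xX; rewrite permE /f ZXn ?s2Z //; right.
have s0E x : x \notin H -> x \notin L -> x \notin Z1 -> x \notin X -> s0 x = x.
  by move=> xH xL xZ xX; rewrite permE /f (negbTE xH) (negbTE xL) s2E.
have s0Z2 x : x \in Z2 -> s0 x = x.
  move=> xZ; apply: s0E; [exact/RH/QR'/Z2Q'|exact: Z2L| |exact: Z2X].
  by apply/negP => /Z1Q; rewrite Z2Q'.
pose S := H :|: L :|: (Z1 :|: X) :|: Z2.
pose T := W :\: S.
have inT x : (x \in T) = [&& x \in W, x \notin H, x \notin L, x \notin Z1, x \notin X & x \notin Z2].
  by rewrite !inE !negb_or; case: (x \in W); rewrite ?andbF ?andbT -?andbA.
have TR x : x \in T -> x \in R by rewrite inT inE => /and3P[-> ->].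
have inS x : x \in W -> x \notin T ->
    x \in H \/ x \in L \/ x \in Z1 \/ x \in X \/ x \in Z2.
  rewrite inT => -> /=; rewrite !negb_and !negbK.
  by case/or4P => [| | |/orP[]] ->; auto 6.
have HQ x b : x \in Q -> b \in H -> e b x -> b = a by move=> xQ bH; rewrite es; apply: Qa.
pose p := s0 a; have pL : p \in L by exact: s0H.
(* [z] is the only possible neighbour of [p] in [R]. If there is none, the default [p] is harmless:
   [zE] holds vacuously. *)
pose z := odflt p [pick z in nbr e p :&: R]; pose q := s0 z.
have zE y : y \in R -> e p y -> y = z.
  move=> yR py; rewrite /z; case: pickP => [y'|/(_ y)] /=; last by rewrite !inE py -in_setD yR.
  rewrite in_setI in_nbr => /andP[py' yR'].
  exact: (pool_nbr_eq Q1 (LQ' _ pL) yR yR').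
have s0eq x y : s0 x = y -> x = s0 y by move=> <-; rewrite s0K.
have noind x y : x \in L :|: X -> y \in L :|: X -> e x y -> False.
  by move=> xL yL; apply/negP; apply: ind.
(* Two vertices of [H :|: Z1] have images in the independent set [L :|: X]; two vertices of
   [L :|: X] are themselves non-adjacent. *)
have cBB x y : x \in H \/ x \in Z1 -> y \in H \/ y \in Z1 -> conf e s0 x y -> False.
  move=> xB yB /andP[_]; apply: noind; rewrite inE.
    by case: xB => [/s0H|/s0Z] ->; rewrite ?orbT.
  by case: yB => [/s0H|/s0Z] ->; rewrite ?orbT.
have cPP x y : x \in L \/ x \in X -> y \in L \/ y \in X -> conf e s0 x y -> False.
  move=> xB yB /andP[+ _]; apply: noind; rewrite inE.
    by case: xB => ->; rewrite ?orbT.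
  by case: yB => ->; rewrite ?orbT.
(* The only possible common edges inside [~: T] are {a, p}, {a, q} and {p, z}. *)
have cHL x y : x \in H -> y \in L -> conf e s0 x y -> (x, y) = (a, p).
  move=> xH yL /andP[xy sxy]; have xa := HQ _ _ (LQ' _ yL) xH xy.
  have /s0eq -> : s0 y = a by apply: (Qa (LQ' _ (s0H _ xH)) (s0L _ yL) sxy).
  by rewrite xa.
have cHX x y : x \in H -> y \in X -> conf e s0 x y -> (x, y) = (a, q).
  move=> xH yX /andP[xy sxy]; have xa := HQ _ _ (XQ' _ yX) xH xy; rewrite xa in sxy *.
  by rewrite /q -(zE _ (Z1R' _ (s0X _ yX)) sxy) s0K.
have cHZ x y : x \in H -> y \in Z2 -> conf e s0 x y -> (x, y) = (a, q).
  move=> xH yZ /andP[xy]; have yQ := Z2Q' _ yZ.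
  have xa := HQ _ _ yQ xH xy; rewrite xa (s0Z2 _ yZ) => sxy.
  by rewrite /q -(zE _ (QR' _ yQ) sxy) (s0Z2 _ yZ).
have cZL x y : x \in Z1 -> y \in L -> conf e s0 x y -> (x, y) = (z, p).
  move=> xZ yL /andP[xy sxy].
  have /s0eq yp : s0 y = a by apply: (Qa (XQ' _ (s0Z _ xZ)) (s0L _ yL) sxy).
  by rewrite yp in xy *; rewrite (zE _ (Z1R' _ xZ)) // es.
have cLZ x y : x \in L -> y \in Z2 -> conf e s0 x y -> (x, y) = (p, z).
  move=> xL yZ /andP[xy]; rewrite (s0Z2 _ yZ) => sxy; have yQ := Z2Q' _ yZ.
  have /s0eq xp := HQ _ _ yQ (s0L _ xL) sxy; rewrite xp in xy *.
  by rewrite (zE _ (QR' _ yQ)).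
have cZ2 x y : x \in R -> x \notin L -> y \in Z2 -> conf e s0 x y -> False.
  move=> xR xL yZ /andP[xy _]; case/negP: xL; apply: (subsetP (NZ2 _ yZ)).
  by rewrite inE in_nbr es xy.
have cZX x y : x \in Z1 -> y \in X -> conf e s0 x y -> False.
  by move=> xZ yX /andP[xy _]; have := XZ1 _ _ yX xZ; rewrite es xy.
pose C := [set (a, p); (p, a); (a, q); (q, a); (p, z); (z, p)].
have inC x y : conf e s0 x y -> (x \in H \/ x \in L \/ x \in Z1 \/ x \in X \/ x \in Z2) ->
    (y \in H \/ y \in L \/ y \in Z1 \/ y \in X \/ y \in Z2) -> (x, y) \in C.
  have half x' y' : conf e s0 x' y' ->
     (x' \in H /\ y' \in L) \/ (x' \in H /\ y' \in X) \/ (x' \in H /\ y' \in Z2) \/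
     (x' \in Z1 /\ y' \in L) \/ (x' \in L /\ y' \in Z2) -> ((x', y') \in C) && ((y', x') \in C).
    move=> cxy; case=> [|[|[|[|]]]] [x'A y'A].
    - by case: (cHL _ _ x'A y'A cxy) => -> ->; rewrite !inE !eqxx ?orbT.
    - by case: (cHX _ _ x'A y'A cxy) => -> ->; rewrite !inE !eqxx ?orbT.
    - by case: (cHZ _ _ x'A y'A cxy) => -> ->; rewrite !inE !eqxx ?orbT.
    - by case: (cZL _ _ x'A y'A cxy) => -> ->; rewrite !inE !eqxx ?orbT.
    - by case: (cLZ _ _ x'A y'A cxy) => -> ->; rewrite !inE !eqxx ?orbT.
  move=> cxy; have cyx : conf e s0 y x by rewrite confC.
  have h1 D := proj1 (andP (half x y cxy D)); have h2 D := proj2 (andP (half y x cyx D)).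
  case=> [|[|[|[|]]]] xA; case=> [|[|[|[|]]]] yA.
  - by case: (cBB x y); auto.
  - by apply: h1; auto 6.
  - by case: (cBB x y); auto.
  - by apply: h1; auto 6.
  - by apply: h1; auto 6.
  - by apply: h2; auto 6.
  - by case: (cPP x y); auto.
  - by apply: h2; auto 6.
  - by case: (cPP x y); auto.
  - by apply: h1; auto 6.
  - by case: (cBB x y); auto.
  - by apply: h1; auto 6.
  - by case: (cBB x y); auto.
  - by case: (cZX x y).
  - by case: (cZ2 x y) => //; [exact: Z1R'|apply: contra (Z1Q _ xA) => /LQ'].
  - by apply: h2; auto 6.
  - by case: (cPP x y); auto.
  - by case: (cZX y x).
  - by case: (cPP x y); auto.
  - by case: (cZ2 x y) => //; [exact/QR'/XQ'|apply: contraL xA => /LX].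
  - by apply: h2; auto 6.
  - by apply: h2; auto 6.
  - by case: (cZ2 y x) => //; [exact: Z1R'|apply: contra (Z1Q _ yA) => /LQ'].
  - by case: (cZ2 y x) => //; [exact/QR'/XQ'|apply: contraL yA => /LX].
  - by case: (cZ2 x y) => //; [exact/QR'/Z2Q'|exact: Z2L].
have s0T x : x \in T -> s0 x \in T.
  move=> xT; rewrite s0E //; by move: xT; rewrite inT => /and5P[_ ? ? ? /andP[]].
have suppr x y : e x y -> y \in W by rewrite es; apply: supp.
(* A neighbour [u] of [T] is not in [L] or [Z2], whose neighbours in [R] were all put into [S]. If
   [u] is in [H], its partner in [L] has no neighbour in [T]; if in [Z1], its partner in the pool
   has at most one; if in [X], its partner in [R] has degree at most [d]. *)
have Tnb v u : v \in T -> u \notin T -> e v u -> #|nbr e (s0 u) :&: T| <= d.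
  move=> vT uT vu; have vR := TR _ vT; have uW := suppr _ _ vu.
  have /and5P[vW vH vL vZ1 /andP[vX vZ2]] : [&& v \in W, v \notin H, v \notin L, v \notin Z1 & (v \notin X) && (v \notin Z2)].
    by rewrite -inT.
  case: (inS _ uW uT) => [|[|[|[|]]]] uA.
  - rewrite (_ : _ :&: T = set0) ?cards0 //; apply/setP => y; rewrite in_setI in_nbr in_set0.
    apply/negP => /andP[uy yT].
    have := subsetP (NL _ (s0H _ uA)) y; rewrite in_setI in_nbr uy (TR _ yT) => /(_ isT).
    by move: yT; rewrite inT inE => /and5P[_ _ _ /negbTE -> /andP[_ /negbTE ->]].
  - have := subsetP (NL _ uA) v; rewrite in_setI in_nbr es vu vR => /(_ isT).
    by rewrite inE (negbTE vZ1) (negbTE vZ2).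
  - apply: leq_trans d0; apply: leq_trans (Q1 (XQ' _ (s0Z _ uA))).
    by apply/subset_leq_card/setIS/subsetP.
  - by apply: leq_trans (Rd (Z1R' _ (s0X _ uA))); apply/subset_leq_card/subsetIl.
  - by have := subsetP (NZ2 _ uA) v; rewrite in_setI in_nbr es vu vR (negbTE vL) => /(_ isT).
(* [S] has at most [2 * #|H| + 2 * #|Z1| + #|Z2|] elements, and [#|Z1| + #|Z2| <= #|H|]. *)
have Tbig u : 2 * (d * d) <= #|T :\ u|.
  have SW : #|S| <= 4 * #|H|.
    apply: leq_trans (leq_card_setU _ _) _.
    have := (leq_card_setU (H :|: L) (Z1 :|: X)).1; have := (leq_card_setU H L).1.
    have := (leq_card_setU Z1 X).1; rewrite Lh -Z1X; move: Zh; clear; lia.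
  have := cardsID S W; have := subset_leq_card (subsetIr W S); have := cardsD1 u T; rewrite -/T;
  move: SW Wh (leq_b1 (u \in T)); clear; lia.
have [s sE sT] : exists2 s : {perm V}, forall x, x \notin T -> s x = s0 x &
    forall v u, v \in T -> ~~ conf e s v u.
  apply: (@swap_packing V e es ei s0 T d d) => //.
  - by move=> x /TR; apply: Rd.
  - move=> x /TR xR; apply: leq_trans (Rd xR); apply/subset_leq_card/subsetIl.
  - by move=> v u vT uT vu; rewrite s0V; apply: Tnb vu.
exists s.
  apply/subsetP => x; rewrite inE; apply: contraR => xW.
  have nR y : y \in R -> x <> y by move=> yR xy; case/negP: xW; rewrite xy RW.
  have xT : x \notin T by apply/negP => /TR/nR.
  rewrite sE // s0E //.
  - by apply: contra xW => /(subsetP HW).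
  - by apply/negP => /LQ'/QR'/nR.
  - by apply/negP => /Z1R'/nR.
  - by apply/negP => /XQ'/QR'/nR.
apply: (@leq_trans #|C|).
  apply/subset_leq_card/subsetP => -[x y]; rewrite inE /= => cxy.
  have xT : x \notin T by apply: contraL cxy => /sT.
  have yT : y \notin T by rewrite confC // in cxy; apply: contraL cxy => /sT.
  have cxy0 : conf e s0 x y by move: cxy; rewrite /conf !sE.
  have [xy _] := andP cxy.
  by apply: inC => //; apply: inS => //; [exact: supp xy|exact: suppr xy].
rewrite /C; do 4!(apply: leq_trans (leq_card_setU _ _) _; rewrite cards1 addn1 ltnS).
by apply: leq_trans (leq_card_setU _ _) _; rewrite !cards1.
Qed.

End Construction.

(** * Deleting leaves and scattered vertices *)

Ltac card_lia := repeat (match goal with |- context [card ?A] =>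
  let n := fresh "n" in set n := card A; clearbody n end); clear; lia.

(* The graph lives on [W] inside the fixed type [V], so that deleting vertices does not change the
   type; [#|arcs e| + 2 * s + 14 <= 4 * #|W|] below means [m + s + 7 <= 2 n]. *)
Definition packs (V : finType) (W : {set V}) (e : rel V) :=
  exists2 s : {perm V}, perm_on W s & #|confs e s| < 8.

Definition simple_in (V : finType) (W : {set V}) (e : rel V) :=
  [/\ symmetric e, irreflexive e & forall x y, e x y -> x \in W].

Definition delete (V : finType) (U : {set V}) (e : rel V) : rel V :=
  fun x y => [&& e x y, x \notin U & y \notin U].

Lemma card_arcs_from (V : finType) (e : rel V) (A : {set V}) :
  #|[set p in arcs e | p.1 \in A]| = \sum_(x in A) #|nbr e x|.
Proof.
rewrite -sum1_card (partition_big fst (mem A)) /=; last by move=> p; rewrite !inE => /andP[].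
apply: eq_bigr => x xA; rewrite -sum1_card.
rewrite (reindex (fun y => (x, y))) /=; last first.
  by exists snd => //= -[u v]; rewrite !inE /= => /andP[_ /eqP ->].
by apply: eq_bigl => y; rewrite !inE /= xA eqxx !andbT.
Qed.

Lemma swap_inj (V : finType) : injective (fun p : V * V => (p.2, p.1)).
Proof. by move=> [x y] [x' y'] [-> ->]. Qed.

Section Reductions.
Variables (V : finType) (W : {set V}) (e : rel V).
Hypothesis eW : simple_in W e.

Lemma simple_delete (U : {set V}) : simple_in (W :\: U) (delete U e).
Proof.
have [es ei supp] := eW; split.
- by move=> x y; rewrite /delete es [(x \notin U) && _]andbC.
- by move=> x; rewrite /delete ei.
- by move=> x y /and3P[/supp xW xU _]; rewrite inE xU.
Qed.

Lemma card_arcs : #|arcs e| = \sum_(x in W) #|nbr e x|.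
Proof.
have [_ _ supp] := eW; rewrite -card_arcs_from; apply: eq_card => -[x y].
by rewrite !inE /=; case: (boolP (e x y)) => // /supp ->.
Qed.

Lemma card_arcs_delete (U : {set V}) :
  #|arcs (delete U e)| + \sum_(x in U) #|nbr e x| <= #|arcs e|.
Proof.
rewrite -card_arcs_from -cardsUI [X in _ + X](_ : _ = 0) ?addn0.
  by apply/subset_leq_card/subsetP => -[x y]; rewrite !inE /= /delete => /orP[/and3P[]|/andP[]].
by apply/eqP; rewrite cards_eq0; apply/eqP/setP => -[x y]; rewrite !inE /= /delete; case: (x \in U); rewrite ?andbF.
Qed.

(** Arcs leaving [U] and arcs entering [U] are disjoint families when [U] is independent, and both
    disappear. *)
Lemma card_arcs_delete_indep (U : {set V}) : {in U &, forall x y, ~~ e x y} ->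
  #|arcs (delete U e)| + 2 * \sum_(x in U) #|nbr e x| <= #|arcs e|.
Proof.
have [es _ _] := eW; move=> ind; rewrite mul2n -addnn addnA.
rewrite -card_arcs_from; set A := [set p in arcs e | _].
pose B := [set (p.2, p.1) | p in A].
have cB : #|B| = #|A| by apply: card_imset; exact: swap_inj.
rewrite -[X in _ + X <= _]cB -[X in X + _]cardsUI.
have inB x y : ((x, y) \in B) = ((y, x) \in A).
  by rewrite -[(x, y)]/((fun p : V * V => (p.2, p.1)) (y, x)) mem_imset //; exact: swap_inj.
have -> : arcs (delete U e) :&: A = set0.
  by apply/setP => -[x y]; rewrite !inE /= /delete; case: (x \in U); rewrite ?andbF.
rewrite cards0 addn0 -cardsUI.
have -> : (arcs (delete U e) :|: A) :&: B = set0.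
  apply/setP => -[x y]; rewrite in_setI inB !inE /= /delete (es y).
  case: (boolP (y \in U)) => yU; rewrite ?andbF //= andbT.
  by apply/negP => /andP[/andP[yx xU]]; rewrite (negbTE (ind _ _ _ _)) in yx.
rewrite cards0 addn0; apply/subset_leq_card/subsetP => -[x y].
by rewrite in_setU inB !inE /= /delete (es y x) => /orP[/orP[/and3P[]|/andP[]]|/andP[]].
Qed.

(** No conflict of [s] meets [U], so each of them is already a conflict of [s'] in the smaller
    graph. *)
Lemma packs_extend (U : {set V}) (s s' : {perm V}) :
  U \subset W -> perm_on (W :\: U) s' -> (forall x, x \notin U -> s x = s' x) ->
  (forall v u, v \in U -> ~~ conf e s v u) -> #|confs (delete U e) s'| < 8 -> packs W e.
Proof.
have [es ei supp] := eW; move=> UW s'W ag nU lt; exists s.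
  apply/subsetP => x; rewrite inE; apply: contraR => xW.
  have xU : x \notin U by apply: contra xW => /(subsetP UW).
  by rewrite ag // (out_perm s'W) // inE (negbTE xW) andbF.
have s'U x : x \notin U -> s' x \notin U.
  move=> xU; apply: contra xU => sU; rewrite -(_ : s' x = x) //.
  by apply: (@perm_inj _ s'); rewrite (out_perm s'W) // inE sU.
apply: leq_ltn_trans lt; apply/subset_leq_card/subsetP => -[x y]; rewrite !inE /= => cxy.
have xU : x \notin U by apply: contraL cxy => /nU.
have yU : y \notin U by rewrite confC // in cxy; apply: contraL cxy => /nU.
by move: cxy; rewrite /conf /delete !ag // xU yU !s'U // !andbT.
Qed.

Variable s : nat.
Hypothesis M : #|arcs e| + 2 * s + 14 <= 4 * #|W|.
Hypothesis IH : forall (W' : {set V}) (e' : rel V), #|W'| < #|W| -> simple_in W' e' ->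
  #|arcs e'| + 2 * s + 14 <= 4 * #|W'| -> packs W' e'.

(** Pairwise distance at least three. *)
Definition far (U : {set V}) :=
  [forall x in U, forall y in U, (x != y) ==> ~~ e x y && [disjoint nbr e x & nbr e y]].

(** Deleting [U] removes [2 * k >= 4] arcs per vertex, so [IH] applies. Every vertex has at most one
    neighbour in [U], so the exchange argument with [d = k] and [c = 1] rearranges [U] without
    conflicts. *)
Lemma packs_far (U : {set V}) (k : nat) : 1 < k -> U \subset W -> far U ->
  {in U, forall x, #|nbr e x| = k} -> 2 * k <= #|U| -> packs W e.
Proof.
have [es ei supp] := eW; move=> k1 UW /forall_inP fU Uk Ubig.
have farP x y : x \in U -> y \in U -> x != y -> ~~ e x y /\ [disjoint nbr e x & nbr e y].
  by move=> xU yU xy; move/forall_inP: (fU _ xU) => /(_ y yU); rewrite xy => /andP[].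
have ind x y : x \in U -> y \in U -> ~~ e x y.
  by move=> xU yU; have [->|/(farP _ _ xU yU)[]//] := eqVneq x y; rewrite ei.
have U0 : 0 < #|U| by lia.
have Wc : #|W :\: U| + #|U| = #|W| by rewrite cardsD (setIidPr UW) subnK // subset_leq_card.
have [|| s' s'W lt] := IH _ (simple_delete U); first by move: Wc U0; clear; lia.
  have := card_arcs_delete_indep ind.
  have -> : \sum_(x in U) #|nbr e x| = #|U| * k by rewrite -sum_nat_const; apply: eq_bigr.
  by move: M Wc k1; clear; nia.
have s'E x : x \in U -> s' x = x by move=> xU; rewrite (out_perm s'W) // inE xU.
have nb1 w : #|nbr e w :&: U| <= 1.
  apply/card_le1_eqP => x y; rewrite !inE => /andP[wx xU] /andP[wy yU].
  apply/eqP; apply: contraTT wx => xy; have [_ dis] := farP _ _ yU xU xy.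
  by apply/negP => wx; move/pred0P: dis => /(_ w); rewrite /= !in_nbr es wy es wx.
have [s1 s1E s1U] : exists2 s1 : {perm V}, forall x, x \notin U -> s1 x = s' x &
    forall v u, v \in U -> ~~ conf e s1 v u.
  apply: (@swap_packing V e es ei s' U k 1) => //.
  - by move=> x xU; rewrite s'E.
  - by move=> x /Uk ->.
  - move=> v u vU vu; have uU : u \notin U by apply: contraTN vu => uU; exact: ind.
    by move: (cardsD1 u U) Ubig; rewrite (negbTE uU); lia.
exact: packs_extend UW s'W s1E s1U lt.
Qed.

(** Delete the two leaves with their neighbours and put them back along a 4-cycle. Then [p] is sent
    to the leaf [v] and is the image of the leaf [u], symmetrically for [q], so edges at the
    high-degree vertices cause no conflict. *)
Lemma packs_leaves p q v u : p != q -> nbr e v = [set p] -> nbr e u = [set q] ->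
  15 < #|nbr e p| -> 15 < #|nbr e q| -> packs W e.
Proof.
have [es ei supp] := eW; move=> pq Nv Nu Np Nq.
have vE y : e v y -> y = p by move=> vy; apply/set1P; rewrite -Nv in_nbr.
have uE y : e u y -> y = q by move=> uy; apply/set1P; rewrite -Nu in_nbr.
have vp : e v p by rewrite -in_nbr Nv set11.
have uq : e u q by rewrite -in_nbr Nu set11.
have v1 : #|nbr e v| = 1 by rewrite Nv cards1.
have u1 : #|nbr e u| = 1 by rewrite Nu cards1.
have nvp : v != p by apply: contraTneq Np => <-; rewrite v1.
have nvq : v != q by apply: contraTneq Nq => <-; rewrite v1.
have nup : u != p by apply: contraTneq Np => <-; rewrite u1.
have nuq : u != q by apply: contraTneq Nq => <-; rewrite u1.
have nuv : u != v by apply: contra_neq pq => E; apply/esym/vE; rewrite -E.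
pose U := [set p; q; v; u].
have UW : U \subset W.
  apply/subsetP => x; rewrite !inE -!orbA => /or4P[]/eqP ->.
  - by apply: (supp _ v); rewrite es.
  - by apply: (supp _ u); rewrite es.
  - exact: supp vp.
  - exact: supp uq.
have U4 : #|U| <= 4.
  rewrite /U; do 2!(apply: leq_trans (leq_card_setU _ _) _; rewrite cards1 addn1 ltnS).
  by apply: leq_trans (leq_card_setU _ _) _; rewrite !cards1.
have pU : p \in U by rewrite !inE eqxx.
have U0 : 0 < #|U| by apply/card_gt0P; exists p.
have Wc : #|W :\: U| + #|U| = #|W| by rewrite cardsD (setIidPr UW) subnK // subset_leq_card.
have [|| s' s'W lt] := IH _ (simple_delete U); first by move: Wc U0; clear; lia.
  (* The 16 arcs leaving [p] pay for at most four vertices, at four arcs each. *)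
  have := card_arcs_delete U; rewrite (bigD1 p) //=; move: M Wc U4 Np; move: (\sum_(_ in _ | _) _) => x; card_lia.
(* [t] is the cycle p -> v -> q -> u -> p. *)
pose t := (tperm p v * tperm p q * tperm p u)%g.
have s'E x : x \in U -> s' x = x by move=> xU; rewrite (out_perm s'W) // inE xU.
have tE x : (t * s')%g x = s' (tperm p u (tperm p q (tperm p v x))) by rewrite !permM.
have tp : (t * s')%g p = v.
  have pqv : tperm p q v = v by rewrite tpermD // eq_sym.
  have puv : tperm p u v = v by rewrite tpermD // eq_sym.
  by rewrite tE tpermL pqv puv s'E // !inE eqxx ?orbT.
have tv : (t * s')%g v = q.
  have puq : tperm p u q = q by rewrite tpermD.
  by rewrite tE tpermR tpermL puq s'E // !inE eqxx ?orbT.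
have tq : (t * s')%g q = u.
  have pvq : tperm p v q = q by rewrite tpermD.
  by rewrite tE pvq tpermR tpermL s'E // !inE eqxx ?orbT.
have tu : (t * s')%g u = p.
  have pvu : tperm p v u = u by rewrite tpermD // eq_sym.
  have pqu : tperm p q u = u by rewrite tpermD // eq_sym.
  by rewrite tE pvu pqu tpermR s'E.
have inj := @perm_inj _ (t * s')%g.
apply: (packs_extend UW s'W (s := (t * s')%g)) lt => [x|x y].
  rewrite !inE !negb_or -!andbA => /and4P[xp xq xv xu].
  by rewrite tE !tpermD // eq_sym.
have nvq' : ~~ e q v by rewrite es; apply: contra_neqN pq => /vE.
have nup' : ~~ e p u by rewrite es; apply: contra_neqN pq => /uE.
rewrite !inE -!orbA => /or4P[] /eqP ->; apply/negP => /andP[].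
- rewrite tp => py /vE sy; have yu : y = u by apply: inj; rewrite sy tu.
  by move: nup'; rewrite -yu py.
- rewrite tq => qy /uE sy; have yv : y = v by apply: inj; rewrite sy tv.
  by move: nvq'; rewrite -yv qy.
- by move=> /vE ->; rewrite tv tp; apply/negP.
- by move=> /uE ->; rewrite tu tq; apply/negP.
Qed.

Definition nbrs (A : {set V}) := \bigcup_(x in A) nbr e x.

(** Take a maximal far subset [F] of [Y]. If it has [2 * k] elements, [packs_far] applies; otherwise
    no vertex of [Y] can be added to it. *)
Lemma far_cover (Y : {set V}) (k : nat) : 1 < k -> Y \subset W ->
  {in Y, forall x, #|nbr e x| = k} ->
  packs W e \/ exists F : {set V}, [/\ F \subset Y, #|F| < 2 * k &
    forall y, y \in Y -> y \in nbrs F \/ y \in nbrs (nbrs F)].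
Proof.
have [es ei supp] := eW; move=> k1 YW Yk.
pose P (A : {set V}) := (A \subset Y) && far A.
have P0 : P set0 by rewrite /P sub0set; apply/forall_inP => x; rewrite inE.
case: (arg_maxnP (fun A : {set V} => #|A|) P0) => F /andP[FY Ff] Fmax.
have [F2k|F2k] := leqP (2 * k) #|F|.
  left; apply: (packs_far k1 _ Ff _ F2k); first exact: subset_trans FY YW.
  by move=> x /(subsetP FY)/Yk.
right; exists F; split=> // y yY.
(* A member of [F] is reached from itself by going to a neighbour and back. *)
have [yF|yF] := boolP (y \in F).
  right; have /card_gt0P[z yz] : 0 < #|nbr e y| by rewrite Yk // ltnW.
  rewrite in_nbr in yz; apply/bigcupP; exists z; last by rewrite in_nbr es.
  by apply/bigcupP; exists y; rewrite ?in_nbr.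
have [yF1|yF1] := boolP (y \in nbrs F); [by left|right].
apply/negPn/negP => yF2.
have nF x : x \in F -> ~~ e x y.
  by move=> xF; apply: contra yF1 => xy; apply/bigcupP; exists x; rewrite ?in_nbr.
have dF x : x \in F -> [disjoint nbr e x & nbr e y].
  move=> xF; apply/pred0P => z /=; apply/negP; rewrite !in_nbr => /andP[xz yz].
  case/negP: yF2; apply/bigcupP; exists z; last by rewrite in_nbr es.
  by apply/bigcupP; exists x; rewrite ?in_nbr.
have: P (y |: F).
  rewrite /P subUset sub1set yY FY /=.
  apply/forall_inP => u; rewrite !inE => uF; apply/forall_inP => v; rewrite !inE => vF.
  apply/implyP => uv; case/orP: uF uv => [/eqP ->|uF]; case/orP: vF => [/eqP ->|vF] uv.
  - by rewrite eqxx in uv.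
  - by rewrite es nF // disjoint_sym dF.
  - by rewrite nF // dF.
  - by move/forall_inP: Ff => /(_ u uF)/forall_inP/(_ v vF); rewrite uv.
by move/Fmax; rewrite cardsU1 yF /=; lia.
Qed.

End Reductions.

(** * Counting the vertices of small degree *)

(** As [s < 2 * n], the cubic assumption forces [n > 125]. If [n < 4400], it also gives
    [s >= 3 * n / 5], hence [M <= 14 * n / 5]; but [(14 / 5)^2 = 7.84 < 8] contradicts density for
    such [n]. *)
Lemma large_of_dense n s M : 8 * (n * n.-1) <= M * M -> M + 2 * s + 14 <= 4 * n ->
  1000 * n ^ 2 <= s ^ 3 -> 4400 <= n.
Proof.
move=> dense Ms s3; rewrite leqNgt; apply/negP => small.
have n0 : 0 < n by lia.
have n125 : 125 < n.
  rewrite ltnNge; apply/negP => le.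
  have : s ^ 3 < (2 * n) ^ 3 by rewrite ltn_exp2r //; lia.
  rewrite expnMn; have : n ^ 3 <= 125 * n ^ 2 by rewrite (expnD n 1 2) expn1 leq_mul2r le orbT.
  by move: s3; rewrite (_ : 2 ^ 3 = 8) //; move: (n ^ 3) (n ^ 2) (s ^ 3); lia.
have s35 : 3 * n <= 5 * s.
  rewrite -(leq_exp2r _ _ (isT : 0 < 3)) !expnMn.
  have : n ^ 3 <= 4400 * n ^ 2 by rewrite (expnD n 1 2) expn1 leq_mul2r ltnW ?orbT.
  rewrite (_ : 3 ^ 3 = 27) // (_ : 5 ^ 3 = 125) //.
  by move: s3; move: (n ^ 3) (n ^ 2) (s ^ 3); lia.
have Mn : 5 * M <= 14 * n by lia.
have : (5 * M) * (5 * M) <= (14 * n) * (14 * n) by apply: leq_mul.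
nia.
Qed.

(** Let [d.+1] be the largest [k] with [4 * k^2 <= n]; [4 * 33^2 = 4356] gives [32 <= d]. With
    [y = 2 * d + 4] one has [n <= y^2], so [(s * y)^6 >= 10^6 * n^7 >= (40 * n)^6], as
    [n >= 4^6 = 4096]. *)
Lemma exists_hub_threshold n s : 4400 <= n -> 1000 * n ^ 2 <= s ^ 3 ->
  exists d, [/\ 32 <= d, 4 * (d.+1 * d.+1) <= n & 40 * n <= s * (2 * d + 4)].
Proof.
move=> n0 s3.
have ex : exists k, 4 * (k * k) <= n by exists 0.
have ub k : 4 * (k * k) <= n -> k <= n by nia.
case: (ex_maxnP ex ub) => k kn kmax.
have k33 : 33 <= k by apply: kmax; apply: leq_trans n0.
have kn1 : n < 4 * (k.+1 * k.+1) by rewrite ltnNge; apply/negP => /kmax; rewrite ltnn.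
exists k.-1; rewrite prednK; last by lia.
split=> //; first by lia.
rewrite (_ : 2 * k.-1 + 4 = 2 * k.+1); last by lia.
have: n <= (2 * k.+1) ^ 2 by nia.
move: (2 * k.+1) => y y2.
rewrite -(leq_exp2r _ _ (isT : 0 < 6)) (_ : 40 = 4 * 10) // !expnMn.
have e1 : 10 ^ 6 * n ^ 4 <= s ^ 6.
  rewrite (expnM s 3 2) (expnM n 2 2) (expnM 10 3 2) -expnMn leq_exp2r //.
have e2 : n ^ 3 <= y ^ 6 by rewrite (expnM y 2 3) leq_exp2r.
have n4 : 4 ^ 6 <= n by apply: leq_trans n0.
apply: leq_trans (leq_mul e1 e2); move: n4; move: (4 ^ 6) (10 ^ 6) => c t cn.
rewrite -[t * _ * _]mulnA -expnD (expnS n 6) (mulnC c) -mulnA leq_mul2l leq_mul2r cn.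
by rewrite !orbT.
Qed.

Section Counting.
Variables (V : finType) (W : {set V}) (e : rel V) (s d : nat).
Hypothesis eW : simple_in W e.
Hypothesis M : #|arcs e| + 2 * s + 14 <= 4 * #|W|.
Hypothesis IH : forall (W' : {set V}) (e' : rel V), #|W'| < #|W| -> simple_in W' e' ->
  #|arcs e'| + 2 * s + 14 <= 4 * #|W'| -> packs W' e'.
Hypotheses (d32 : 32 <= d) (dW : 4 * (d.+1 * d.+1) <= #|W|) (sd : 40 * #|W| <= s * (2 * d + 4)).

(* [H] is the set of hubs and [Q b] the pool at the hub [b]. *)
Let H := [set x in W | d < #|nbr e x|].
Let R := W :\: H.
Let tau x := #|nbr e x :&: H|.
Let rho x := #|nbr e x :&: R|.
Let Q b := [set x in R | (nbr e x :&: H \subset [set b]) && (rho x <= 1)].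
Let Y i j := [set x in R | (tau x == i) && (rho x == j)].
Let Q0 := [set x in R | (tau x == 0) && (rho x <= 1)].

Let inH x : (x \in H) = (x \in W) && (d < #|nbr e x|). Proof. by rewrite inE. Qed.
Let HW : H \subset W. Proof. by apply/subsetP => x; rewrite inE => /andP[]. Qed.
Let RW : R \subset W. Proof. exact: subsetDl. Qed.
Let inR x : (x \in R) = (x \in W) && (x \notin H). Proof. by rewrite in_setD andbC. Qed.
Let inW x y : e x y -> y \in W.
Proof. by have [es _ supp] := eW; rewrite es; apply: supp. Qed.

Let Rd x : x \in R -> #|nbr e x| <= d.
Proof. by rewrite inR inH => /andP[->] /=; rewrite -leqNgt. Qed.

Let nbrE x : #|nbr e x| = tau x + rho x.
Proof.
rewrite -(cardsID H); congr (_ + _); apply: eq_card => y.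
by rewrite !inE; case: (boolP (e x y)) => [/inW ->|]; rewrite ?andbF.
Qed.

Let sum_nbrE (A : {set V}) :
  \sum_(x in A) #|nbr e x| = \sum_(x in A) tau x + \sum_(x in A) rho x.
Proof. by rewrite -big_split; apply: eq_bigr => x _; apply: nbrE. Qed.

Let sumHR : \sum_(x in W) #|nbr e x| = \sum_(x in R) #|nbr e x| + \sum_(x in H) #|nbr e x|.
Proof.
rewrite (bigID (mem H)) /= addnC; congr (_ + _); apply: eq_bigl => x; rewrite ?inR //.
by rewrite inH andbA andbb.
Qed.

(** Hubs send as many arcs to non-hubs as they receive from them. *)
Let sumRE : \sum_(x in W) #|nbr e x| =
  2 * \sum_(x in R) tau x + \sum_(x in R) rho x + \sum_(x in H) tau x.
Proof.
have [es _ _] := eW.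
rewrite sumHR !sum_nbrE.
suff -> : \sum_(x in H) rho x = \sum_(x in R) tau x by lia.
have sumE (A B : {set V}) : \sum_(x in A) #|nbr e x :&: B| = \sum_(x in A) \sum_(y in B) e x y.
  apply: eq_bigr => x _; rewrite -sum1_card [RHS]big_mkcond [LHS]big_mkcond /=.
  by apply: eq_bigr => y _; rewrite !inE andbC; case: (y \in B) => //=; case: (e x y).
rewrite /rho /tau !sumE exchange_big /=; apply: eq_bigr => x _; apply: eq_bigr => y _.
by rewrite es.
Qed.

Let cardHle : #|H| * d.+1 <= \sum_(x in H) tau x + \sum_(x in R) tau x.
Proof.
suff : #|H| * d.+1 <= \sum_(x in H) #|nbr e x|.
  have := sumRE; rewrite sumHR [X in X + _]sum_nbrE; lia.
by rewrite -sum_nat_const; apply: leq_sum => x; rewrite inH => /andP[].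
Qed.

Let not_packs_pool b : b \in H -> ~ packs W e -> #|Q b| < 2 * #|H| + d.
Proof.
have [es ei supp] := eW; move=> bH np; rewrite ltnNge; apply/negP => Qb; apply: np.
suff [s1 s1W le6] : exists2 s1, perm_on W s1 & #|confs e s1| <= 6.
  by exists s1 => //; apply: leq_ltn_trans le6 _.
apply: (@near_packing_of_pool V e W H (Q b) b d) => //.
- by apply/subsetP => x; rewrite inE => /andP[].
- move=> x b' /[!inE] /and3P[_ /subsetP sub _] b'H xb'.
  by apply/set1P; apply: sub; rewrite !inE xb'.
- by move=> x; rewrite inE => /and3P[].
- exact: leq_trans d32.
(* Hub degrees sum to at most [4 * n], so [33 * h <= 4 * n] and [4 * h < n / 2]; also
   [2 * d^2 < n / 2]. *)
- have := cardHle; have := sumRE; rewrite -(card_arcs eW); move: M d32 dW.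
  move: (\sum_(x in R) tau x) (\sum_(x in R) rho x) (\sum_(x in H) tau x) => ta rh et.
  move: (#|arcs e|) (#|W|) (#|H|) => m n h; clear.
  nia.
Qed.

Let card_nbrs_le (A : {set V}) k : {in A, forall x, #|nbr e x| <= k} -> #|nbrs e A| <= #|A| * k.
Proof. exact: card_bigcup_le. Qed.

(** By [far_cover], [Y 0 k] lies within two steps of fewer than [2 * k] vertices of degree [k],
    whose neighbours are non-hubs and so have degree at most [d]. *)
Let card_hubless k : 1 < k -> ~ packs W e -> #|Y 0 k| <= (2 * k).-1 * k * d.+1.
Proof.
have [es ei supp] := eW; move=> k1 np.
have Yk : {in Y 0 k, forall x, #|nbr e x| = k}.
  by move=> x; rewrite inE nbrE => /and3P[_ /eqP -> /eqP ->].
have YW : Y 0 k \subset W by apply/subsetP => x; rewrite inE => /andP[/(subsetP RW)].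
have [//|[F [FY F2k Fcov]]] := far_cover eW M IH k1 YW Yk.
have NR z : z \in nbrs e F -> z \in R.
  move=> /bigcupP[x /(subsetP FY)]; rewrite inE cards_eq0 in_nbr => /and3P[_ /eqP t0 _] xz.
  rewrite inR (inW xz) /=; apply/negP => zH.
  have : z \in nbr e x :&: H by rewrite in_setI in_nbr xz.
  by rewrite t0 inE.
have c1 : #|nbrs e F| <= #|F| * k.
  by apply: card_nbrs_le => x /(subsetP FY)/Yk ->.
have c2 : #|nbrs e (nbrs e F)| <= #|nbrs e F| * d by apply: card_nbrs_le => x /NR/Rd.
have : #|Y 0 k| <= #|nbrs e F :|: nbrs e (nbrs e F)|.
  by apply/subset_leq_card/subsetP => y /Fcov; rewrite inE => -[] ->; rewrite ?orbT.
move=> /leq_trans; apply; apply: leq_trans (leq_card_setU _ _) _.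
apply: (@leq_trans (#|nbrs e F| * d.+1)); first by rewrite mulnS leq_add2l.
rewrite leq_mul2r /=; apply: leq_trans c1 _; rewrite leq_mul2r; apply/orP; right.
by rewrite -ltnS prednK //; lia.
Qed.

Let Q0Q b : Q0 \subset Q b.
Proof.
apply/subsetP => x; rewrite !inE cards_eq0 => /and3P[-> /eqP -> ->].
by rewrite sub0set.
Qed.

(** [A] and [Q0] are disjoint parts of the same pool, because [tau] is positive on [A] and zero on
    [Q0]. *)
Let card_add_Q0 b i j (A : {set V}) : b \in H -> ~ packs W e -> 0 < i -> 
  A \subset Y i j -> A \subset Q b -> #|A| + #|Q0| < 2 * #|H| + d.
Proof.
move=> bH np i0 AY AQ; apply: leq_ltn_trans (not_packs_pool bH np).
rewrite -cardsUI (_ : A :&: Q0 = set0) ?cards0 ?addn0.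
  by apply/subset_leq_card; rewrite subUset AQ Q0Q.
apply/setP => x; rewrite in_setI in_set0; apply/negP => /andP[/(subsetP AY)].
rewrite !inE => /and3P[_ /eqP -> _] /and3P[_ /eqP i00 _].
by rewrite i00 in i0.
Qed.

Let hub_nbr x y : x \in Y 1 y -> exists2 b, b \in H & nbr e x :&: H = [set b].
Proof.
rewrite inE => /and3P[_ /cards1P[b bE] _]; exists b => //.
by have := set11 b; rewrite -bE inE => /andP[].
Qed.

(** By [packs_leaves] all leaves attached to hubs hang on one hub, so they belong to its pool. *)
Let card_leaves : H != set0 -> ~ packs W e -> #|Y 1 0| + #|Q0| < 2 * #|H| + d.
Proof.
have [es ei supp] := eW.
case/set0Pn => a aH np; have [->|[v vY]] := set_0Vmem (Y 1 0).
  rewrite cards0; apply: leq_ltn_trans (not_packs_pool aH np).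
  exact/subset_leq_card/Q0Q.
have hubN x b : x \in Y 1 0 -> nbr e x :&: H = [set b] -> nbr e x = [set b].
  rewrite inE cards_eq0 => /and3P[_ _ /eqP r0] bE; apply/setP => y; rewrite -bE in_setI in_nbr.
  case: (boolP (e x y)) => //= xy; suff -> : y \in H by [].
  apply: contraT => yH; have : y \in nbr e x :&: R by rewrite in_setI in_nbr xy inR yH (inW xy).
  by rewrite r0 inE.
have [p pH pE] := hub_nbr vY; have vN := hubN _ _ vY pE.
apply: (card_add_Q0 (b := p) (i := 1) (j := 0)) => //.
apply/subsetP => u uY; have [q qH qE] := hub_nbr uY; have uN := hubN _ _ uY qE.
have -> : p = q.
  apply/eqP/negPn/negP => pq; apply: np; apply: (packs_leaves eW M IH pq vN uN).
    by move: pH; rewrite inH => /andP[_]; apply: leq_ltn_trans; apply: leq_trans d32.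
  by move: qH; rewrite inH => /andP[_]; apply: leq_ltn_trans; apply: leq_trans d32.
by move: uY; rewrite !inE => /and3P[-> _ /eqP ->]; rewrite qE subxx.
Qed.

(** [far_cover] with [k = 2] gives at most three vertices, with at most three non-hub neighbours
    [NR] and three hub neighbours [NH]. A vertex of [Y 1 1] is in [NR], next to [NR], or in the pool
    of a hub of [NH]. *)
Let card_hub_edge : ~ packs W e ->
  #|Y 1 1| <= 3 * d.+1 + 3 * ((2 * #|H| + d).-1 - #|Q0|).
Proof.
have [es ei supp] := eW; move=> np.
have Yk : {in Y 1 1, forall x, #|nbr e x| = 2}.
  by move=> x; rewrite inE nbrE => /and3P[_ /eqP -> /eqP ->].
have YW : Y 1 1 \subset W by apply/subsetP => x; rewrite inE => /andP[/(subsetP RW)].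
have [//|[F [FY F4 Fcov]]] := far_cover eW M IH (isT : 1 < 2) YW Yk.
pose NR := \bigcup_(x in F) (nbr e x :&: R).
pose NH := \bigcup_(x in F) (nbr e x :&: H).
have cR : #|NR| <= 3.
  apply: (@leq_trans (#|F| * 1)); last by rewrite muln1.
  by apply: card_bigcup_le => x /(subsetP FY); rewrite inE => /and3P[_ _ /eqP E]; rewrite -/(rho x) E.
have cH : #|NH| <= 3.
  apply: (@leq_trans (#|F| * 1)); last by rewrite muln1.
  by apply: card_bigcup_le => x /(subsetP FY); rewrite inE => /and3P[_ /eqP E _]; rewrite -/(tau x) E.
have NE z : z \in nbrs e F -> z \in NR \/ z \in NH.
  move=> /bigcupP[x xF]; rewrite in_nbr => xz.
  have [zH|zH] := boolP (z \in H).
    by right; apply/bigcupP; exists x; rewrite // in_setI in_nbr xz.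
  by left; apply/bigcupP; exists x; rewrite // in_setI in_nbr xz inR zH (inW xz).
have NHH b : b \in NH -> b \in H by case/bigcupP => x _; rewrite inE => /andP[].
pose B b := Y 1 1 :&: nbr e b.
have cB b : b \in NH -> #|B b| <= (2 * #|H| + d).-1 - #|Q0|.
  move=> /NHH bH; suff : #|B b| + #|Q0| < 2 * #|H| + d by clear; lia.
  apply: (card_add_Q0 bH np (i := 1) (j := 1)) => //; first exact: subsetIl.
  apply/subsetP => x; rewrite in_setI in_nbr => /andP[xY bx].
  have [p pH pE] := hub_nbr xY; move: xY; rewrite !inE => /and3P[-> _ /eqP ->].
  have : b \in nbr e x :&: H by rewrite in_setI in_nbr es bx.
  by rewrite pE inE => /eqP ->; rewrite subxx.
have : #|Y 1 1| <= #|NR :|: nbrs e NR :|: \bigcup_(b in NH) B b|.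
  apply/subset_leq_card/subsetP => y yY; rewrite !in_setU.
  have yR : y \in R by move: yY; rewrite inE => /andP[].
  case: (Fcov _ yY) => [/NE[->//|/NHH]|]; first by rewrite inR in yR; case/andP: yR => _ /negbTE ->.
  case/bigcupP => z /NE[zR|zH] yz; first by rewrite (_ : y \in nbrs e NR) ?orbT //; apply/bigcupP; exists z.
  rewrite (_ : y \in \bigcup_(b in NH) B b) ?orbT //; apply/bigcupP; exists z => //.
  by rewrite in_setI yY.
move=> /leq_trans; apply; apply: leq_trans (leq_card_setU _ _) _.
apply: leq_add; last by apply: leq_trans (card_bigcup_le cB) _; rewrite leq_mul2r cH orbT.
apply: leq_trans (leq_card_setU _ _) _.
have : #|nbrs e NR| <= #|NR| * d.
  by apply: card_nbrs_le => z /bigcupP[x _]; rewrite in_setI => /andP[_]; apply: Rd.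
move: cR; clear; nia.
Qed.

(** With truncated subtraction only the types [(tau, rho)] listed on the right have
    [2 * tau + rho < 4]; each coefficient is the largest deficit of its class. *)
Let sum_deficit : \sum_(x in R) (4 - (2 * tau x + rho x)) <=
  4 * #|Q0| + 2 * #|Y 0 2| + #|Y 0 3| + 2 * #|Y 1 0| + #|Y 1 1|.
Proof.
have cE (A : {set V}) : A \subset R -> #|A| = \sum_(x in R) (x \in A).
  move=> AR; rewrite -sum1_card [RHS]big_mkcond [LHS]big_mkcond /=; apply: eq_bigr => x _.
  by case: (boolP (x \in A)) => [/(subsetP AR) ->|_]; case: (x \in R).
have YR i j : Y i j \subset R by apply/subsetP => x; rewrite inE => /andP[].
have QR0 : Q0 \subset R by apply/subsetP => x; rewrite inE => /andP[].
rewrite !cE // !big_distrr -!big_split /=; apply: leq_sum => x xR.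
have inY i j : (x \in Y i j) = (tau x == i) && (rho x == j) by rewrite inE xR.
have -> : (x \in Q0) = (tau x == 0) && (rho x <= 1) by rewrite inE xR.
rewrite !inY.
case: (tau x) => [|[|t]] /=; case: (rho x) => [|[|[|[|r]]]] //=; lia.
Qed.

Lemma packs_step : packs W e.
Proof.
have [es ei supp] := eW.
(* Without hubs all degrees are at most [d], and [2 * d^2 < #|W|] lets the exchange argument act on
   the whole of [W]. *)
have [H0|Hn0] := eqVneq H set0.
  have RW' : R = W by rewrite /R H0 setD0.
  have dR x : x \in W -> #|nbr e x| <= d by rewrite -RW'; apply: Rd.
  have [s1 s1E s1W] : exists2 s1 : {perm V}, forall x, x \notin W -> s1 x = (1%g : {perm V}) x &
      forall v u, v \in W -> ~~ conf e s1 v u.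
    apply: (@swap_packing V e es ei 1%g W d d) => //.
    - by move=> x xW; rewrite perm1.
    - by move=> x xW; apply: leq_trans (dR _ xW); apply/subset_leq_card/subsetIl.
    - by move=> v u _ uW /inW; rewrite (negbTE uW).
    - by move=> v u _ uW /inW; rewrite (negbTE uW).
    - by move=> v u vW _; have := cardsD1 u W; move: dW; clear; case: (u \in W) => /=; nia.
  exists s1.
    by apply/subsetP => x; rewrite inE; apply: contraR => xW; rewrite s1E // perm1.
  rewrite (_ : confs e s1 = set0) ?cards0 //; apply/setP => -[x y]; rewrite !inE /=.
  have [xW|xW] := boolP (x \in W); first by apply/negbTE/s1W.
  by apply/negP => /andP[/supp]; rewrite (negbTE xW).
have [/existsP[s1 /andP[s1W lt]]|/existsPn none] :=
  boolP [exists s1 : {perm V}, perm_on W s1 && (#|confs e s1| < 8)]; first by exists s1.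
have np : ~ packs W e by case=> s1 s1W lt; move: (none s1); rewrite s1W lt.
exfalso; have := card_leaves Hn0 np; have := card_hub_edge np.
have := card_hubless (isT : 1 < 2) np; have := card_hubless (isT : 1 < 3) np.
have := sum_deficit; have := cardHle; have := sumRE; rewrite -(card_arcs eW).
have : 4 * (#|W| - #|H|) <= 2 * \sum_(x in R) tau x + \sum_(x in R) rho x +
    \sum_(x in R) (4 - (2 * tau x + rho x)).
  rewrite -cardsDS // mulnC -sum_nat_const big_distrr -!big_split /=.
  by apply: leq_sum => x _; lia.
have := subset_leq_card HW; move: M d32 dW sd.
move: (\sum_(x in R) (4 - _)) (\sum_(x in R) tau x) (\sum_(x in R) rho x) (\sum_(x in H) tau x).
move: (#|arcs e|) (#|W|) (#|H|) (#|Q0|) (#|Y 0 2|) (#|Y 0 3|) (#|Y 1 0|) (#|Y 1 1|).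
clear; move=> m n h q y2 y3 l y1 om ta rh et.
move=> Ms d32 dn sd hn le4 mE hd omE y3E y2E y1E lE.
(* The sum of deficits [om] is at most [10 * h + 35 * d.+1]: pools contribute [10 * h + 5 * d], and
   the terms [12 + 15 + 3] times [d.+1] come from [Y 0 2], [Y 0 3] and [Y 1 1]. Another [4 * h]
   comes from [n - h]. *)
have main : 2 * s + 14 + et <= 14 * h + 35 * d.+1 by lia.
(* Multiply by [d.+1] and use [h * d.+1 <= et + ta] and [2 * ta + et <= 4 * n - 2 * s - 14]. The
   right side is then at most [28 * n + 35 * n / 4 < 40 * n] apart from terms that cancel,
   contradicting the choice of [d]. *)
have := leq_mul main (leqnn d.+1); have : 7 * et <= et * d.+1.
  by rewrite mulnC leq_mul2l; apply/orP; right; move: d32; clear; lia.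
have : s * (2 * d + 4) = 2 * (s * d.+1) + 2 * s by clear; nia.
rewrite !mulnDl -!mulnA; move: dn sd hd; move: (d.+1 * d.+1) (et * _) (s * d.+1) (h * _) (s * _).
lia.
Qed.

End Counting.

(** * The induction on the order *)

Theorem sparse_packs (V : finType) (W : {set V}) (e : rel V) s :
  simple_in W e -> #|arcs e| + 2 * s + 14 <= 4 * #|W| -> 1000 * #|W| ^ 2 <= s ^ 3 ->
  packs W e.
Proof.
have [n] := ubnP #|W|; elim: n W e => // n IHn W e; rewrite ltnS => Wn eW M s3.
have [es ei supp] := eW.
(* The averaging lemma with [b = 8]: fewer than eight ordered pairs are at most three edges. *)
have [sparse|dense] := ltnP (#|arcs e| * #|arcs e|) (8 * (#|W| * #|W|.-1)).
  exact: exists_few_conf sparse.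
have n0 := large_of_dense dense M s3.
have [d [d32 dW sd]] := exists_hub_threshold n0 s3.
apply: (packs_step eW M _ d32 dW sd) => W' e' W'W e'W M'.
apply: IHn => //; first exact: leq_trans Wn.
(* [s] stays fixed, so the cubic condition survives when [W] shrinks. *)
by apply: leq_trans s3; rewrite leq_mul2l leq_exp2r // ltnW.
Qed.

(** * From relations to graphs *)

Lemma card_pairs (T : finType) (F : {set {set T}}) : (forall A, A \in F -> #|A| = 2) ->
  #|[set p : T * T | [set p.1; p.2] \in F]| = 2 * #|F|.
Proof.
move=> F2; rewrite mulnC -sum_nat_const -sum1_card.
rewrite (partition_big (fun p : T * T => [set p.1; p.2]) (mem F)) /=; last by move=> p; rewrite inE.
apply: eq_bigr => A AF; have /eqP/cards2P[x [y [xy AE]]] := F2 _ AF.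
transitivity #|[set (x, y); (y, x)]|; last by rewrite cards2 xpair_eqE negb_and xy.
rewrite -sum1_card; apply: eq_bigl => -[u v]; rewrite !inE /= !xpair_eqE.
apply/andP/orP => [[_ /eqP E]|].
  have uA : u \in A by rewrite -E set21.
  have vA : v \in A by rewrite -E set22.
  have xE : x \in [set u; v] by rewrite E AE set21.
  have yE : y \in [set u; v] by rewrite E AE set22.
  move: uA vA xE yE; rewrite AE !inE => /orP[] /eqP ->.
    move=> /orP[] /eqP ->; rewrite ?eqxx; last by left.
    by rewrite !(eq_sym y) (negbTE xy).
  move=> /orP[] /eqP ->; rewrite ?eqxx; first by right.
  by rewrite (negbTE xy).
case=> /andP[/eqP -> /eqP ->]; first by rewrite -AE AF eqxx.
by rewrite setUC -AE AF eqxx.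
Qed.

Lemma graph_near_packing (G : graph) s :
  #|edges G| + s + 7 <= 2 * #|vertex G| -> 1000 * #|vertex G| ^ 2 <= s ^ 3 ->
  exists t : {perm vertex G}, common_size t <= 3.
Proof.
move=> m s3; pose e : rel (vertex G) := fun x y => [set x; y] \in edges G.
have e2 A : A \in edges G -> #|A| = 2 by exact: edges_card2.
have eW : simple_in setT e.
  split=> [x y|x|x y _]; rewrite ?inE // /e 1?setUC //.
  by apply/negP => /e2; rewrite setUid cards1.
have [|| t _ lt] := sparse_packs eW (s := s); rewrite ?cardsT //.
  by rewrite (card_pairs e2); lia.
(* The inverse appears because [xy] is an edge of the image under [t^-1] exactly when [t x] and
   [t y] are adjacent. *)
exists t^-1%g; rewrite /common_size; set F := _ :&: _.
have F2 A : A \in F -> #|A| = 2 by rewrite inE => /andP[/e2].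
have cE : confs e t = [set p | [set p.1; p.2] \in F].
  apply/setP => -[x y]; rewrite [LHS]inE [RHS]inE /= in_setI; congr (_ && _).
  have tA : t @: [set x; y] = [set t x; t y] by rewrite imsetU1 imset_set1.
  have imK (u : {perm vertex G}) (A : {set vertex G}) : u @: (u^-1%g @: A) = A.
    by rewrite -imset_comp (eq_imset (g := id)) ?imset_id // => z /=; rewrite permKV.
  apply/idP/imsetP => [txy|[A AE xyE]].
    exists (t @: [set x; y]); first by rewrite tA.
    by have := imK t^-1%g [set x; y]; rewrite invgK.
  by rewrite /e -tA xyE imK.
by move: lt; rewrite cE (card_pairs F2); lia.
Qed.

(** * Complete bipartite graphs and the upper bound *)

Section Join.
Variable T : finType.

Definition join (P Q : {set T}) : {set {set T}} := [set [set p.1; p.2] | p in setX P Q].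

Lemma in_join (P Q : {set T}) x y : x \in P -> y \in Q -> [set x; y] \in join P Q.
Proof. by move=> xP yQ; apply/imsetP; exists (x, y); rewrite // inE xP. Qed.

Lemma joinP (P Q : {set T}) A :
  reflect (exists x y, [/\ x \in P, y \in Q & A = [set x; y]]) (A \in join P Q).
Proof.
apply: (iffP imsetP) => [[[x y] /=]|[x [y [xP yQ ->]]]].
  by rewrite inE => /andP[/= xP yQ ->]; exists x, y.
by exists (x, y); rewrite // inE xP.
Qed.

Lemma card_join (P Q : {set T}) : [disjoint P & Q] -> #|join P Q| = #|P| * #|Q|.
Proof.
move=> PQ; rewrite card_in_imset ?cardsX // => -[x y] [x' y']; rewrite !inE /=.
move=> /andP[xP yQ] /andP[xP' yQ'] E.
have nPQ u v : u \in P -> v \in Q -> (u == v) = false.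
  by move=> uP vQ; apply/negbTE; apply: contraTneq uP => ->; rewrite (disjointFl PQ vQ).
have : x \in [set x'; y'] by rewrite -E set21.
have : y \in [set x'; y'] by rewrite -E set22.
by rewrite !inE (nPQ x y') // orbF (eq_sym y x') (nPQ x' y) //= => /eqP -> /eqP ->.
Qed.

Fact join_card2 (A : {set T}) C : C \in join A (~: A) -> #|C| = 2.
Proof.
case/joinP => x [y [xA]]; rewrite inE => yA ->; rewrite cards2.
by case: eqVneq => // xy; rewrite -xy xA in yA.
Qed.

Lemma join_perm (s : {perm T}) (A : {set T}) :
  [set s @: C | C : {set T} in join A (~: A)] = join (s @: A) (~: (s @: A)).
Proof.
have inj := @perm_inj _ s; apply/setP => C; apply/imsetP/joinP => [[D /joinP[x [y [xA yA ->]]] ->]|].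
  exists (s x), (s y); rewrite inE !mem_imset // -in_setC; split=> //.
  by rewrite imsetU1 imset_set1.
case=> x [y [/imsetP[x' xA ->] yA ->]]; exists [set x'; (s^-1)%g y].
  apply: in_join => //; rewrite inE; apply: contraL yA => yA; rewrite inE negbK.
  by apply/imsetP; exists ((s^-1)%g y); rewrite ?permKV.
by rewrite imsetU1 imset_set1 permKV.
Qed.

(** Common edges include those from [A :&: B] to the outside of [A :|: B], and those between
    [A :\: B] and [B :\: A]. With [k = #|A :&: B|] these number [k * (n - 4 + k) + (2 - k)^2], that
    is [4], [n - 2] or [2 * (n - 2)]. *)
Lemma card_join_common (A B : {set T}) : 6 <= #|T| -> #|A| = 2 -> #|B| = 2 ->
  4 <= #|join A (~: A) :&: join B (~: B)|.
Proof.
move=> T6 A2 B2; pose J1 := join (A :&: B) (~: (A :|: B)); pose J2 := join (A :\: B) (B :\: A).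
have sub : J1 :|: J2 \subset join A (~: A) :&: join B (~: B).
  apply/subsetP => C; rewrite inE => /orP[] /joinP[x [y [+ + ->]]]; rewrite !inE.
    rewrite negb_or => /andP[xA xB] /andP[yA yB].
    by rewrite !in_join // inE.
  move=> /andP[xB xA] /andP[yA yB]; rewrite in_join ?inE //= setUC.
  by rewrite in_join // inE.
have J12 : J1 :&: J2 = set0.
  apply/setP => C; rewrite !inE; apply/negP => /andP[/joinP[x [y [xAB _ ->]]] /joinP[u [v [uA vB E]]]].
  have : x \in [set u; v] by rewrite -E set21.
  by move: xAB; rewrite !inE => /andP[xA xB] /orP[] /eqP xE; move: uA vB; rewrite -xE !inE xA xB ?andbF.
have cJ1 : #|J1| = #|A :&: B| * #|~: (A :|: B)|.
  by apply: card_join; rewrite -setI_eq0; apply/eqP/setP => x; rewrite !inE; case: (x \in A); case: (x \in B).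
have cJ2 : #|J2| = #|A :\: B| * #|B :\: A|.
  by apply: card_join; rewrite -setI_eq0; apply/eqP/setP => x; rewrite !inE; case: (x \in A); case: (x \in B).
apply: leq_trans (subset_leq_card sub).
rewrite (_ : #|J1 :|: J2| = #|J1| + #|J2|); last by rewrite -cardsUI J12 cards0 addn0.
rewrite cJ1 cJ2.
have := cardsID B A; have := cardsID A B; rewrite (setIC B A) A2 B2.
have := cardsUI A B; have := cardsC (A :|: B); rewrite A2 B2.
move: T6; move: (#|A :&: B|) (#|A :|: B|) (#|A :\: B|) (#|B :\: A|) (#|~: (A :|: B)|) (#|T|).
clear; move=> k u a b c n n6 E1 E2 E3 E4.
have [-> -> ->] : [/\ a = 2 - k, b = 2 - k & c = n - 4 + k] by split; lia.
have : k <= 2 by lia.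
by case: k {E1 E2 E3 E4} => [|[|[|]]] //=; lia.
Qed.

End Join.

Definition biclique2 (n : nat) : graph := Graph (@join_card2 _ [set i : 'I_n | i < 2]).

Lemma card_lt2 n : 1 < n -> #|[set i : 'I_n | i < 2]| = 2.
Proof.
move=> n2; have n1 := ltnW n2.
rewrite (_ : [set i : 'I_n | i < 2] = [set Ordinal n1; Ordinal n2]) ?cards2 //.
by apply/setP => -[[|[|i]] lti]; rewrite !inE.
Qed.

Lemma card_biclique2 n : 1 < n -> #|edges (biclique2 n)| = 2 * (n - 2).
Proof.
move=> n2; rewrite card_join; last by rewrite -setI_eq0 setICr.
by rewrite [X in _ * X]cardsCs setCK card_lt2 // card_ord.
Qed.

Lemma common_biclique2 n (s : {perm vertex (biclique2 n)}) : 6 <= n -> 4 <= common_size s.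
Proof.
move=> n6; rewrite /common_size /= join_perm.
have A2 : #|[set i : 'I_n | i < 2]| = 2 by apply: card_lt2; lia.
by apply: card_join_common; rewrite ?card_ord // card_imset //; exact: perm_inj.
Qed.

(* Real estimates and asymptotics *)
From HB Require Import structures.
From mathcomp Require Import all_order all_algebra.
From mathcomp Require Import all_classical all_reals all_analysis.
From mathcomp Require Import lra.
Import Order.TTheory GRing.Theory Num.Theory.
Import numFieldNormedType.Exports.
Local Open Scope classical_set_scope.
Local Open Scope ring_scope.

Section RealBounds.
Variable R : realType.

Lemma powR23_cube (n : nat) : (n%:R `^ (2 / 3) : R) ^+ 3 = n%:R ^+ 2.
Proof.
rewrite -powR_mulrn ?powR_ge0 // -powRrM (_ : 2 / 3 * 3 = 2%:R); last by lra.
by rewrite powR_mulrn.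
Qed.

Lemma nat_size_bound (n m : nat) : m%:R <= 2 * n%:R - 10 * n%:R `^ (2 / 3) - 7 :> R ->
  exists s, (m + s + 7 <= 2 * n)%N /\ (1000 * n ^ 2 <= s ^ 3)%N.
Proof.
move=> le; have p0 : 0 <= n%:R `^ (2 / 3) :> R := powR_ge0 _ _.
have m7 : (m + 7 <= 2 * n)%N by rewrite -(ler_nat R) natrD natrM; lra.
(* The largest admissible [s]; it is at least [10 * n^(2/3)], and cubing gives the second
   condition. *)
exists (2 * n - 7 - m)%N; split; first by lia.
rewrite -(ler_nat R) natrM !natrX -powR23_cube.
have sE : (2 * n - 7 - m)%:R = 2 * n%:R - 7 - m%:R :> R.
  by rewrite !natrB ?natrM //; lia.
rewrite (_ : 1000%:R = 10 ^+ 3 :> R) -?exprMn; last by rewrite -natrX.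
by apply: lerXn2r; rewrite ?nnegrE ?sE; lra.
Qed.

Lemma graph_near_packing_real (G : graph) :
  #|edges G|%:R <= 2 * #|vertex G|%:R - 10 * #|vertex G|%:R `^ (2 / 3) - 7 :> R ->
  exists t : {perm vertex G}, (common_size t <= 3)%N.
Proof. by case/nat_size_bound => s [ms s3]; apply: graph_near_packing ms s3. Qed.

Lemma bin2_gt3 n : (6 <= n)%N -> (4 <= 'C(n, 2))%N.
Proof. by move=> n6; apply: leq_trans (leq_bin2l 2 n6). Qed.

Lemma f_lower n : (6 <= n)%N -> 2 * n%:R - 10 * n%:R `^ (2 / 3) - 7 < (f n 4)%:R :> R.
Proof.
move=> n6; have [[G [Gn Gk <-]] _] := f_min (bin2_gt3 n6).
rewrite ltNge -Gn; apply/negP => /graph_near_packing_real[t].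
by rewrite leqNgt Gk.
Qed.

Lemma f_upper n : (6 <= n)%N -> (f n 4 <= 2 * n - 4)%N.
Proof.
move=> n6; have [_ lb] := f_min (bin2_gt3 n6).
apply: lb; exists (biclique2 n); split; first by rewrite card_ord.
  by move=> t; apply: common_biclique2.
by rewrite card_biclique2 ?mulnBr // ltnW // (leq_trans _ n6).
Qed.

(** As [mu] bounds all packable sizes, it suffices that the floor is one of them. *)
Lemma mu_lower n : (6 <= n)%N ->
  Num.floor (2 * n%:R - 10 * n%:R `^ (2 / 3) - 7 : R) <= mu n (graphs_le 3).
Proof.
move=> n6; have [_ ub] := mu_max (bin2_gt3 n6).
apply: ub => G Gn m; have [|t t3] := @graph_near_packing_real G; last by exists t.
rewrite Gn; apply: le_trans (ge_floor _).
by rewrite pmulrn ler_int.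
Qed.

Lemma f_littleo :
  (fun n : nat => (f n 4)%:R : R^o) =
    (fun n : nat => 2 * n%:R : R^o) +o_\oo (fun n : nat => n%:R : R^o).
Proof.
apply/eqaddoP => eps eps0; near=> n.
have n6 : (6 <= n)%N by near: n; exact: nbhs_infty_ge.
(* Since [n^(2/3) >= 1], the error [10 * n^(2/3) + 7] is at most [17 * n^(2/3)], which is below
   [eps * n] once [n >= (17 / eps)^3]. *)
have nbig : (17 / eps) ^+ 3 <= n%:R by near: n; exact: nbhs_infty_ger.
have n1 : 1 <= n%:R :> R by rewrite ler1n (leq_trans _ n6).
have p1 : 1 `^ (2 / 3) <= n%:R `^ (2 / 3) :> R by apply: ge0_ler_powR; rewrite ?nnegrE //; lra.
rewrite powR1 in p1.
have lo := f_lower n6; have hi := f_upper n6.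
have hi' : (f n 4)%:R <= 2 * n%:R :> R by rewrite -natrM ler_nat (leq_trans hi) // leq_subr.
have p17 : 17 * n%:R `^ (2 / 3) <= eps * n%:R.
  have e0 : 0 <= eps * n%:R by apply: mulr_ge0; [exact: ltW|exact: ler0n].
  have p0 : 0 <= 17 * n%:R `^ (2 / 3) :> R by lra.
  rewrite -(ler_pXn2r (isT : (0 < 3)%N) p0 e0) !exprMn powR23_cube.
  rewrite [n%:R ^+ 3]exprS mulrA; apply: ler_wpM2r; first exact: exprn_ge0.
  by move: nbig; rewrite expr_div_n ler_pdivrMr ?exprn_gt0 // mulrC.
rewrite /= [`|n%:R|]ger0_norm // ler_norml /= ?fctE.
apply/andP; split; lra.
Unshelve. all: by end_near.
Qed.
End RealBounds.

Theorem theorem1 (R : realType) :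
  (forall n : nat, (6 <= n)%N ->
     2 * n%:R - 10 * n%:R `^ (2 / 3) - 7 < (f n 4)%:R :> R /\
     (f n 4)%:R <= 2 * n%:R - 4 :> R) /\
  (fun n : nat => (f n 4)%:R : R^o) =
    (fun n : nat => 2 * n%:R : R^o) +o_\oo (fun n : nat => n%:R : R^o) /\
  (forall n : nat, (6 <= n)%N ->
     Num.floor (2 * n%:R - 10 * n%:R `^ (2 / 3) - 7 : R)
       <= mu n (graphs_le 3)).
Proof.
split=> [n n6|]; last by split; [exact: f_littleo|exact: mu_lower].
split; first exact: f_lower.
have n4 : (4 <= 2 * n)%N by rewrite (leq_trans _ (leq_mul (leqnn 2) n6)).
by rewrite -natrM -natrB // ler_nat f_upper.
Qed.
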